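(* Let $R$ be a Noetherian commutative ring. Let $M$ be an $R$-module and let $\{M_i\}$ be the set of the finitely generated submodules of $M$ (directed by inclusion). Then $M$ is a flat $R$-module if and only if $$\mathcal M=\varinjlim_i\mathcal M_{i,sch},$$ i.e. the natural morphism $\mathcal M=\varinjlim_i\mathcal M_i\to\varinjlim_i\mathcal M_{i,sch}$ is an isomorphism of $\mathcal R$-modules.
   Context: All functors are covariant functors on the category of commutative $R$-algebras. $\mathcal R$ is the functor of rings $\mathcal R(R'):=R'$. An $\mathcal R$-module $\mathbb M$ is a functor of abelian groups with a morphism of functors $\mathcal R\times\mathbb M\to\mathbb M$ making each $\mathbb M(R')$ an $R'$-module; morphisms are natural transformations that are $R'$-linear for every $R'$. Direct limits are computed pointwise. For an $R$-module $M$ (resp. $M_i$), $\mathcal M$ (resp. $\mathcal M_i$) denotes the $\mathcal R$-module $\mathcal M(R'):=M\otimes_RR'$. For an $R$-module $N$ with $N^*=\mathrm{Hom}_R(N,R)$, the $\mathcal R$-module $\mathcal N_{sch}$ is given by $\mathcal N_{sch}(R')=\mathrm{Hom}_R(N^*,R')$; it is functorial in $N$. There is a natural morphism $\mathcal N\to\mathcal N_{sch}$ given by $N\otimes_RR'\to\mathrm{Hom}_R(N^*,R')$, $n\otimes r'\mapsto(w\mapsto w(n)r')$. Here $\mathcal M_{i,sch}:=(\mathcal M_i)_{sch}$, with transition morphisms induced by the inclusions $M_i\subseteq M_j$. *)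

(* Defs.v *)
From HB Require Import structures.
From mathcomp Require Import all_boot all_order all_algebra.
From mathcomp Require Import mathcomp_extra boolp.

Set Implicit Arguments.
Unset Strict Implicit.
Unset Printing Implicit Defensive.

Import GRing.Theory.
Local Open Scope ring_scope.
Local Open Scope quotient_scope.

(* Rings are [comPzRingType]s, so that the zero ring is allowed, both as base
   ring and as algebra.                                                       *)

(* The library's [comAlgType] excludes the zero algebra, hence this record.   *)
Record comAlg (R : comPzRingType) := ComAlg {
  alg_ring :> comPzRingType;
  alg_str : {rmorphism R -> alg_ring}
}.

Record algHom (R : comPzRingType) (A B : comAlg R) := AlgHom {
  algHom_fun :> {rmorphism A -> B};
  algHom_str : forall a, algHom_fun (alg_str A a) = alg_str B a
}.

Section AlgHom.
Variable R : comPzRingType.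
Implicit Types A B C : comAlg R.

Definition algHom_id A : algHom A A := @AlgHom R A A idfun (fun=> erefl).

Fact algHom_comp_str A B C (g : algHom B C) (f : algHom A B) a :
  (g \o f) (alg_str A a) = alg_str C a.
Proof. by rewrite /= !algHom_str. Qed.

Definition algHom_comp A B C (g : algHom B C) (f : algHom A B) : algHom A C :=
  @AlgHom R A C (g \o f) (algHom_comp_str g f).

(* A as an R-module, through its structure map. *)
Definition algMod A : Type := A.

HB.instance Definition _ A := GRing.Zmodule.copy (algMod A) (alg_ring A).

Definition algMod_scale A (a : R) (x : algMod A) : algMod A :=
  alg_str A a * (x : A).

Fact algMod_scaleA A a b (x : algMod A) :
  algMod_scale a (algMod_scale b x) = algMod_scale (a * b) x.
Proof. by rewrite /algMod_scale rmorphM mulrA. Qed.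

Fact algMod_scale1 A : left_id 1 (@algMod_scale A).
Proof. by move=> x; rewrite /algMod_scale rmorph1 mul1r. Qed.

Fact algMod_scaleDr A : right_distributive (@algMod_scale A) +%R.
Proof. by move=> a x y; rewrite /algMod_scale mulrDr. Qed.

Fact algMod_scaleDl A (x : algMod A) :
  {morph (@algMod_scale A)^~ x : a b / a + b}.
Proof. by move=> a b; rewrite /algMod_scale rmorphD mulrDl. Qed.

HB.instance Definition _ A :=
  GRing.Zmodule_isLmodule.Build R (algMod A) (@algMod_scaleA A)
    (@algMod_scale1 A) (@algMod_scaleDr A) (@algMod_scaleDl A).

Lemma algMod_scaleE A a (x : algMod A) : a *: x = alg_str A a * (x : A).
Proof. by []. Qed.

Definition algHom_mod A B (f : algHom A B) (x : algMod A) : algMod B := f x.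

Fact algHom_mod_linear A B (f : algHom A B) : linear (algHom_mod f).
Proof.
move=> a x y; rewrite /algHom_mod.
by rewrite [LHS]rmorphD rmorphM algHom_str.
Qed.

HB.instance Definition _ A B (f : algHom A B) :=
  GRing.isLinear.Build R (algMod A) (algMod B) *:%R (algHom_mod f)
    (algHom_mod_linear f).

Definition alg_mul A (b : A) (x : algMod A) : algMod A := b * (x : A).

Fact alg_mul_linear A (b : A) : linear (@alg_mul A b).
Proof.
move=> a x y; rewrite /alg_mul [LHS]mulrDr; congr (_ + _).
by rewrite !algMod_scaleE mulrCA.
Qed.

HB.instance Definition _ A (b : A) :=
  GRing.isLinear.Build R (algMod A) (algMod A) *:%R (alg_mul b)
    (alg_mul_linear b).

End AlgHom.

Section Tensor.
Variables (R : comPzRingType) (M N : lmodType R).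

(* A word [:: (x1, n1); ...; (xk, nk)] stands for the sum of the xi (x) ni.
   The words modulo [tens_eq] form the commutative monoid presented by the
   relations of a tensor product; it is a group, as (- x) (x) n is opposite
   to x (x) n.                                                                *)
Inductive tens_eq : seq (M * N) -> seq (M * N) -> Prop :=
| tens_refl s : tens_eq s s
| tens_sym s t : tens_eq s t -> tens_eq t s
| tens_trans s t u : tens_eq s t -> tens_eq t u -> tens_eq s u
| tens_cat s s' t t' : tens_eq s s' -> tens_eq t t' ->
    tens_eq (s ++ t) (s' ++ t')
| tens_catC s t : tens_eq (s ++ t) (t ++ s)
| tens_0 n : tens_eq [:: (0, n)] [::]
| tens_Dl x y n : tens_eq [:: (x + y, n)] [:: (x, n); (y, n)]
| tens_Dr x m n : tens_eq [:: (x, m + n)] [:: (x, m); (x, n)]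
| tens_Z a x n : tens_eq [:: (a *: x, n)] [:: (x, a *: n)].

Definition tens_eqb (s t : seq (M * N)) : bool := `[< tens_eq s t >].

Fact tens_eqb_refl : reflexive tens_eqb.
Proof. by move=> s; apply/asboolP/tens_refl. Qed.

Fact tens_eqb_sym : symmetric tens_eqb.
Proof. by move=> s t; apply/asboolP/asboolP => /tens_sym. Qed.

Fact tens_eqb_trans : transitive tens_eqb.
Proof.
by move=> s t u /asboolP st /asboolP /(tens_trans st) tu; apply/asboolP.
Qed.

Canonical tens_equiv :=
  EquivRel tens_eqb tens_eqb_refl tens_eqb_sym tens_eqb_trans.

Definition tensor : Type := {eq_quot tens_equiv}.

HB.instance Definition _ := Choice.on tensor.
HB.instance Definition _ := EqQuotient.on tensor.

Lemma tens_piP (s t : seq (M * N)) :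
  \pi_tensor s = \pi_tensor t <-> tens_eq s t.
Proof. by split => [/eqmodP/asboolP//|h]; apply/eqmodP/asboolP. Qed.

Lemma tens_repr (s : seq (M * N)) : tens_eq (repr (\pi_tensor s)) s.
Proof. by apply/tens_piP; rewrite reprK. Qed.

Definition tens_zero : tensor := \pi_tensor [::].
Definition tens_add (t u : tensor) : tensor := \pi_tensor (repr t ++ repr u).
Definition tens_opp (t : tensor) : tensor :=
  \pi_tensor [seq (- p.1, p.2) | p <- repr t].

Fact tens_add_pi s t : tens_add (\pi s) (\pi t) = \pi_tensor (s ++ t).
Proof. by apply/tens_piP/tens_cat; apply: tens_repr. Qed.

Fact tens_addA : associative tens_add.
Proof.
by elim/quotW=> s; elim/quotW=> t; elim/quotW=> u; rewrite !tens_add_pi catA.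
Qed.

Fact tens_addC : commutative tens_add.
Proof.
elim/quotW=> s; elim/quotW=> t; rewrite !tens_add_pi.
exact/tens_piP/tens_catC.
Qed.

Fact tens_add0 : left_id tens_zero tens_add.
Proof. by elim/quotW=> s; rewrite tens_add_pi. Qed.

Fact tens_addN : left_inverse tens_zero tens_opp tens_add.
Proof.
move=> t; rewrite /tens_opp -{2}[t]reprK tens_add_pi; apply/tens_piP.
elim: (repr t) => [|[x n] s IHs] /=; first exact: tens_refl.
set s' := [seq _ | _ <- s] in IHs *.
have e1 : tens_eq ([:: (- x, n)] ++ ((s' ++ [:: (x, n)]) ++ s))
                  ([:: (- x, n)] ++ (([:: (x, n)] ++ s') ++ s)).
  apply: tens_cat (tens_refl _) _; apply: tens_cat _ (tens_refl _).
  exact: tens_catC.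
rewrite -catA /= in e1; apply: (tens_trans e1).
change (tens_eq ([:: (- x, n); (x, n)] ++ (s' ++ s)) ([::] ++ [::])).
apply: tens_cat _ IHs.
have := tens_sym (tens_Dl (- x) x n); rewrite addNr => e2.
exact: tens_trans e2 (tens_0 n).
Qed.

HB.instance Definition _ :=
  GRing.isZmodule.Build tensor tens_addA tens_addC tens_add0 tens_addN.

Lemma tens_piD (s t : seq (M * N)) :
  \pi_tensor s + \pi_tensor t = \pi_tensor (s ++ t).
Proof. exact: tens_add_pi. Qed.

Definition tens (x : M) (n : N) : tensor := \pi_tensor [:: (x, n)].

Lemma tensDl x y n : tens (x + y) n = tens x n + tens y n.
Proof. by rewrite tens_piD; apply/tens_piP/tens_Dl. Qed.

Lemma tensDr x m n : tens x (m + n) = tens x m + tens x n.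
Proof. by rewrite tens_piD; apply/tens_piP/tens_Dr. Qed.

Lemma tensZ a x n : tens (a *: x) n = tens x (a *: n).
Proof. exact/tens_piP/tens_Z. Qed.

Lemma tens_piE (s : seq (M * N)) :
  \pi_tensor s = \sum_(p <- s) tens p.1 p.2.
Proof.
elim: s => [|[x n] s IHs]; first by rewrite big_nil.
by rewrite big_cons -IHs tens_piD.
Qed.

Lemma tensor_ind (P : tensor -> Prop) :
  P 0 -> (forall x n t, P t -> P (tens x n + t)) -> forall t, P t.
Proof.
move=> P0 PD; elim/quotW=> s; rewrite tens_piE.
by elim: s => [|p s IHs]; rewrite ?big_nil ?big_cons //; apply: PD.
Qed.

Record balanced (P : zmodType) (f : M -> N -> P) : Prop := Balanced {
  balancedDl : forall x y n, f (x + y) n = f x n + f y n;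
  balancedDr : forall x m n, f x (m + n) = f x m + f x n;
  balancedZ : forall a x n, f (a *: x) n = f x (a *: n)
}.

Definition tens_desc (P : zmodType) (f : M -> N -> P) (t : tensor) : P :=
  \sum_(p <- repr t) f p.1 p.2.

Section Desc.
Variables (P : zmodType) (f : M -> N -> P).
Hypothesis fP : balanced f.

Fact tens_desc_pi s : tens_desc f (\pi s) = \sum_(p <- s) f p.1 p.2.
Proof.
suff sum_eq t u : tens_eq t u ->
    \sum_(p <- t) f p.1 p.2 = \sum_(p <- u) f p.1 p.2.
  exact/sum_eq/tens_repr.
elim=> {s t u} //.
- by move=> s t u _ -> _ ->.
- by move=> s s' t t' _ es _ et; rewrite !big_cat /= es et.
- by move=> s t; rewrite !big_cat /= addrC.
- move=> n; rewrite big_seq1 big_nil /=.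
  by apply: (addrI (f 0 n)); rewrite -balancedDl // !addr0.
- by move=> x y n; rewrite big_seq1 big_cons big_seq1 /= balancedDl.
- by move=> x y n; rewrite big_seq1 big_cons big_seq1 /= balancedDr.
- by move=> a x n; rewrite !big_seq1 /= balancedZ.
Qed.

Lemma tens_descE x n : tens_desc f (tens x n) = f x n.
Proof. by rewrite tens_desc_pi big_seq1. Qed.

Lemma tens_descD : {morph tens_desc f : t u / t + u}.
Proof.
elim/quotW=> s; elim/quotW=> t.
by rewrite tens_piD !tens_desc_pi big_cat.
Qed.

Lemma tens_desc0 : tens_desc f 0 = 0.
Proof. by rewrite tens_desc_pi big_nil. Qed.

End Desc.

Lemma tensor_ext (P : zmodType) (f g : tensor -> P) :
    {morph f : t u / t + u} -> {morph g : t u / t + u} ->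
  (forall x n, f (tens x n) = g (tens x n)) -> f =1 g.
Proof.
have morph0 (h : tensor -> P) : {morph h : t u / t + u} -> h 0 = 0.
  by move=> hD; apply: (addrI (h 0)); rewrite -hD !addr0.
move=> fD gD fg; elim/tensor_ind=> [|x n t IHt]; first by rewrite !morph0.
by rewrite fD gD fg IHt.
Qed.

End Tensor.

Section TensorMap.
Variables (R : comPzRingType) (M M' N N' : lmodType R).
Variables (u : {linear M -> M'}) (v : {linear N -> N'}).

Definition tensor_map : tensor M N -> tensor M' N' :=
  tens_desc (fun x n => tens (u x) (v n)).

Fact tensor_map_balanced : balanced (fun x n => tens (u x) (v n)).
Proof.
split=> [x y n|x m n|a x n]; first by rewrite linearD tensDl.
  by rewrite linearD tensDr.
by rewrite !linearZ_LR tensZ.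
Qed.

Lemma tensor_mapE x n : tensor_map (tens x n) = tens (u x) (v n).
Proof. exact: tens_descE tensor_map_balanced _ _. Qed.

Lemma tensor_mapD : {morph tensor_map : s t / s + t}.
Proof. exact: tens_descD tensor_map_balanced. Qed.

End TensorMap.

Definition exact_at (V V' V'' : zmodType) (f : V -> V') (g : V' -> V'') : Prop :=
  forall y, g y = 0 <-> exists x, f x = y.

Definition flat (R : comPzRingType) (M : lmodType R) : Prop :=
  forall (N N' N'' : lmodType R) (f : {linear N -> N'}) (g : {linear N' -> N''}),
  exact_at f g ->
  exact_at (tensor_map (idfun : {linear M -> M}) f)
           (tensor_map (idfun : {linear M -> M}) g).

Section Span.
Variables (R : comPzRingType) (M : lmodType R).

Definition span_seq (s : seq M) : pred M :=
  fun x => `[< exists c : nat -> R, x = \sum_(i < size s) c i *: s`_i >].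

Fact span_seq_closed s : subsemimod_closed (span_seq s).
Proof.
split; first split.
- by apply/asboolP; exists (fun=> 0); rewrite big1 // => i _; rewrite scale0r.
- move=> x y /asboolP[c ->] /asboolP[d ->]; apply/asboolP.
  exists (fun i => c i + d i); rewrite -big_split /=.
  by apply: eq_bigr => i _; rewrite scalerDl.
- move=> a x /asboolP[c ->]; apply/asboolP; exists (fun i => a * c i).
  by rewrite scaler_sumr; apply: eq_bigr => i _; rewrite scalerA.
Qed.

HB.instance Definition _ s :=
  GRing.isSubmodClosed.Build R M (span_seq s) (span_seq_closed s).

Lemma span_seq_nth s i : (i < size s)%N -> s`_i \in span_seq s.
Proof.
move=> lt_i_s; apply/asboolP; exists (fun j => (j == i)%:R).
rewrite (bigD1 (Ordinal lt_i_s)) //= eqxx scale1r big1 ?addr0 // => j.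
by rewrite -val_eqE /= => /negPf->; rewrite scale0r.
Qed.

Lemma span_seq_mem s x : x \in s -> x \in span_seq s.
Proof. by move=> sx; rewrite -(nth_index 0 sx) span_seq_nth ?index_mem. Qed.

Lemma span_seq_min s (S : submodClosed M) :
  {subset s <= S} -> {subset span_seq s <= S}.
Proof.
move=> sS x /asboolP[c ->]; apply: rpred_sum => i _.
by apply/rpredZ/sS/mem_nth.
Qed.

Record fgSubmod := FgSubmod {
  fg_mem :> submodClosed M;
  fg_gen : exists s : seq M, fg_mem =i span_seq s
}.

Definition fgSubmod_span (s : seq M) : fgSubmod :=
  @FgSubmod (GRing.SubmodClosed.clone R M (span_seq s) _)
    (ex_intro _ s (fun=> erefl)).

Definition submod (S : fgSubmod) : Type := {x : M | x \in fg_mem S}.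

HB.instance Definition _ S := SubChoice.on (submod S).
HB.instance Definition _ S := [SubChoice_isSubLmodule of submod S by <:].

Definition subfg (S T : fgSubmod) : Prop := {subset fg_mem S <= fg_mem T}.

Definition submod_incl (S T : fgSubmod) (ST : subfg S T) (x : submod S) :
  submod T := Sub (val x) (ST _ (valP x)).

Fact submod_incl_linear S T (ST : subfg S T) : linear (submod_incl ST).
Proof. by move=> a x y; apply/val_inj; rewrite !linearP. Qed.

HB.instance Definition _ S T (ST : subfg S T) :=
  GRing.isLinear.Build R (submod S) (submod T) *:%R (submod_incl ST)
    (submod_incl_linear ST).

Definition submod_val (S : fgSubmod) (x : submod S) : M := val x.

Fact submod_val_linear S : linear (@submod_val S).
Proof. by move=> a x y; rewrite /submod_val linearP. Qed.

HB.instance Definition _ S :=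
  GRing.isLinear.Build R (submod S) M *:%R (@submod_val S) (@submod_val_linear S).

Fact subfg_directed (S T : fgSubmod) :
  exists U : fgSubmod, subfg S U /\ subfg T U.
Proof.
have [[s Ss] [t Tt]] := (fg_gen S, fg_gen T).
exists (fgSubmod_span (s ++ t)); rewrite /subfg /=; split=> x.
- rewrite Ss => /span_seq_min; apply=> y sy.
  by apply: span_seq_mem; rewrite mem_cat sy.
- rewrite Tt => /span_seq_min; apply=> y ty.
  by apply: span_seq_mem; rewrite mem_cat ty orbT.
Qed.

End Span.

(* The submodules of R^o are the ideals of R. *)
Definition noetherian (R : comPzRingType) : Prop :=
  forall I : submodClosed R^o, exists s : seq R^o, I =i span_seq s.

(* [Rmod R] is the type of R-modules in the sense of functors on the category
   of commutative R-algebras: [fmapZ] is the naturality of the action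
   R' x F(R') -> F(R') in R'.                                                 *)
Record Rmod (R : comPzRingType) := MkRmod {
  fobj :> forall A : comAlg R, lmodType A;
  fmap : forall A B : comAlg R, algHom A B -> fobj A -> fobj B;
  fmap_id : forall A (x : fobj A), fmap (algHom_id A) x = x;
  fmap_comp : forall A B C (g : algHom B C) (f : algHom A B) (x : fobj A),
    fmap (algHom_comp g f) x = fmap g (fmap f x);
  fmapD : forall A B (f : algHom A B) (x y : fobj A),
    fmap f (x + y) = fmap f x + fmap f y;
  fmapZ : forall A B (f : algHom A B) (a : A) (x : fobj A),
    fmap f (a *: x) = f a *: fmap f x
}.
Arguments fmap {R} F {A B} f x : rename.

Record RmodHom (R : comPzRingType) (F G : Rmod R) := MkRmodHom {
  hom_at :> forall A : comAlg R, {linear F A -> G A};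
  hom_nat : forall A B (f : algHom A B) (x : F A),
    hom_at B (fmap F f x) = fmap G f (hom_at A x)
}.

Definition RmodIso (R : comPzRingType) (F G : Rmod R) (u : RmodHom F G) : Prop :=
  exists v : RmodHom G F,
    (forall A (x : F A), v A (u A x) = x) /\
    (forall A (y : G A), u A (v A y) = y).

Section RmodComp.
Variables (R : comPzRingType) (F G H : Rmod R).
Variables (v : RmodHom G H) (u : RmodHom F G).

Definition RmodHom_comp_at (A : comAlg R) : {linear F A -> H A} := v A \o u A.

Fact RmodHom_comp_nat A B (f : algHom A B) (x : F A) :
  RmodHom_comp_at B (fmap F f x) = fmap H f (RmodHom_comp_at A x).
Proof. by rewrite /= !hom_nat. Qed.

Definition RmodHom_comp : RmodHom F H := MkRmodHom RmodHom_comp_nat.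

End RmodComp.

Section BaseChange.
Variables (R : comPzRingType) (M : lmodType R) (A : comAlg R).

Definition baseChange : Type := tensor M (algMod A).

HB.instance Definition _ := GRing.Zmodule.on baseChange.

Definition baseChange_scale (a : A) : baseChange -> baseChange :=
  tensor_map (idfun : {linear M -> M}) (alg_mul a : {linear _ -> _}).

Fact baseChange_scale_tens a x (r : algMod A) :
  baseChange_scale a (tens x r) = tens x (a * (r : A) : algMod A).
Proof. exact: tensor_mapE. Qed.

Fact baseChange_scaleDr : right_distributive baseChange_scale +%R.
Proof. by move=> a; apply: tensor_mapD. Qed.

Fact baseChange_scaleA a b t :
  baseChange_scale a (baseChange_scale b t) = baseChange_scale (a * b) t.
Proof.
move: t; apply: tensor_ext; try by move=> t u; rewrite !baseChange_scaleDr.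
by move=> x r; rewrite !baseChange_scale_tens mulrA.
Qed.

Fact baseChange_scale1 : left_id 1 baseChange_scale.
Proof.
apply: tensor_ext => //; first exact: baseChange_scaleDr.
by move=> x r; rewrite baseChange_scale_tens mul1r.
Qed.

Fact baseChange_scaleDl t : {morph baseChange_scale^~ t : a b / a + b}.
Proof.
move=> a b; move: t; apply: tensor_ext => [t u|t u|x r].
- exact: baseChange_scaleDr.
- by rewrite !baseChange_scaleDr addrACA.
- by rewrite !baseChange_scale_tens mulrDl tensDr.
Qed.

HB.instance Definition _ :=
  GRing.Zmodule_isLmodule.Build A baseChange baseChange_scaleA
    baseChange_scale1 baseChange_scaleDr baseChange_scaleDl.

Lemma baseChangeZ (a : A) x (r : algMod A) :
  a *: (tens x r : baseChange) = tens x (a * (r : A) : algMod A).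
Proof. exact: baseChange_scale_tens. Qed.

End BaseChange.

(* [qcoh M] is the functor A |-> M (x)_R A, and [sch N] below is the functor
   A |-> Hom_R(N^*, A).                                                       *)
Section QCoh.
Variables (R : comPzRingType) (M : lmodType R).

Definition qcoh_map (A B : comAlg R) (f : algHom A B) :
    baseChange M A -> baseChange M B :=
  tensor_map (idfun : {linear M -> M}) (algHom_mod f : {linear _ -> _}).

Fact qcoh_map_tens A B (f : algHom A B) x r :
  qcoh_map f (tens x r) = tens x (algHom_mod f r).
Proof. exact: tensor_mapE. Qed.

Fact qcoh_mapD A B (f : algHom A B) (t u : baseChange M A) :
  qcoh_map f (t + u) = qcoh_map f t + qcoh_map f u.
Proof. exact: tensor_mapD. Qed.

Fact qcoh_map_id A (t : baseChange M A) : qcoh_map (algHom_id A) t = t.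
Proof.
move: t; apply: tensor_ext => //; first exact: qcoh_mapD.
by move=> x r; rewrite qcoh_map_tens.
Qed.

Fact qcoh_map_comp A B C (g : algHom B C) (f : algHom A B)
  (t : baseChange M A) : qcoh_map (algHom_comp g f) t = qcoh_map g (qcoh_map f t).
Proof.
move: t; apply: tensor_ext; try by move=> t u; rewrite !qcoh_mapD.
by move=> x r; rewrite !qcoh_map_tens.
Qed.

Fact qcoh_mapZ A B (f : algHom A B) (a : A) (t : baseChange M A) :
  qcoh_map f (a *: t) = f a *: qcoh_map f t.
Proof.
move: t; apply: tensor_ext => [t u|t u|x r].
- by rewrite scalerDr qcoh_mapD.
- by rewrite qcoh_mapD scalerDr.
- rewrite qcoh_map_tens !baseChangeZ qcoh_map_tens.
  by rewrite /algHom_mod rmorphM.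
Qed.

Definition qcoh : Rmod R :=
  MkRmod qcoh_map_id qcoh_map_comp qcoh_mapD qcoh_mapZ.

End QCoh.

Section QCohHom.
Variables (R : comPzRingType) (M M' : lmodType R) (u : {linear M -> M'}).

Definition qcoh_hom_fun (A : comAlg R) : qcoh M A -> qcoh M' A :=
  tensor_map u (idfun : {linear algMod A -> algMod A}).

Fact qcoh_hom_tens A x r : @qcoh_hom_fun A (tens x r) = tens (u x) r.
Proof. exact: tensor_mapE. Qed.

Fact qcoh_homD A : {morph @qcoh_hom_fun A : t t' / t + t'}.
Proof. exact: tensor_mapD. Qed.

Fact qcoh_hom_linear A : linear (@qcoh_hom_fun A).
Proof.
move=> a t t'; rewrite qcoh_homD; congr (_ + _).
move: t; apply: tensor_ext => [t t''|t t''|x r].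
- by rewrite scalerDr qcoh_homD.
- by rewrite qcoh_homD scalerDr.
- by rewrite qcoh_hom_tens !baseChangeZ qcoh_hom_tens.
Qed.

HB.instance Definition _ (A : comAlg R) :=
  GRing.isLinear.Build A (qcoh M A) (qcoh M' A) *:%R (@qcoh_hom_fun A)
    (@qcoh_hom_linear A).

Fact qcoh_hom_nat A B (f : algHom A B) (t : qcoh M A) :
  qcoh_hom_fun (fmap (qcoh M) f t) = fmap (qcoh M') f (qcoh_hom_fun t).
Proof.
move: t; apply: tensor_ext.
- by move=> t t'; rewrite fmapD qcoh_homD.
- by move=> t t'; rewrite qcoh_homD fmapD.
by move=> x r; rewrite /= qcoh_hom_tens !qcoh_map_tens qcoh_hom_tens.
Qed.

Definition qcoh_hom : RmodHom (qcoh M) (qcoh M') :=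
  @MkRmodHom R (qcoh M) (qcoh M') (fun A => @qcoh_hom_fun A : {linear _ -> _})
    qcoh_hom_nat.

End QCohHom.

Lemma linear_ext (R : pzRingType) (U V : lmodType R) (f g : {linear U -> V}) :
  f =1 g -> f = g.
Proof.
case: f => f [[f1] [f2]]; case: g => g [[g1] [g2]] /= /funext fg.
case: _ / fg in g1 g2 *.
by rewrite (Prop_irrelevance f1 g1) (Prop_irrelevance f2 g2).
Qed.

Section LinHom.
Variables (R : comPzRingType) (U V : lmodType R).

Definition linHom : Type := {linear U -> V}.

HB.instance Definition _ := gen_eqMixin linHom.
HB.instance Definition _ := gen_choiceMixin linHom.

Definition linHom_app (f : linHom) : U -> V := (f : {linear U -> V}).

Lemma linHomP (f g : linHom) : linHom_app f =1 linHom_app g -> f = g.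
Proof. exact: linear_ext. Qed.

Definition linHom_fun (f : U -> V) (_ : linear f) : U -> V := f.

HB.instance Definition _ (f : U -> V) (fL : linear f) :=
  GRing.isLinear.Build R U V *:%R (linHom_fun fL) fL.

Definition linHom_of (f : U -> V) (fL : linear f) : linHom :=
  (linHom_fun fL : {linear U -> V}).

Lemma linHom_linear (f : linHom) : linear (linHom_app f).
Proof. exact: linearP. Qed.

Lemma linHomD (f : linHom) x y :
  linHom_app f (x + y) = linHom_app f x + linHom_app f y.
Proof. exact: linearD. Qed.

Lemma linHomZ (f : linHom) a x : linHom_app f (a *: x) = a *: linHom_app f x.
Proof. exact: linearZ. Qed.

Fact linHom0_linear : linear (fun _ : U => 0 : V).
Proof. by move=> a x y; rewrite scaler0 addr0. Qed.

Fact linHomD_linear (f g : linHom) :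
  linear (fun x => linHom_app f x + linHom_app g x).
Proof. by move=> a x y; rewrite !linHom_linear scalerDr addrACA. Qed.

Fact linHomN_linear (f : linHom) : linear (fun x => - linHom_app f x).
Proof. by move=> a x y; rewrite linHom_linear opprD scalerN. Qed.

Fact linHomZ_linear (b : R) (f : linHom) : linear (fun x => b *: linHom_app f x).
Proof.
by move=> a x y; rewrite linHom_linear scalerDr !scalerA [b * a]mulrC.
Qed.

Definition linHom_zero : linHom := linHom_of linHom0_linear.
Definition linHom_add f g : linHom := linHom_of (linHomD_linear f g).
Definition linHom_opp f : linHom := linHom_of (linHomN_linear f).
Definition linHom_scale b f : linHom := linHom_of (linHomZ_linear b f).

Fact linHom_addA : associative linHom_add.
Proof. by move=> f g h; apply: linHomP => x; apply: addrA. Qed.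
Fact linHom_addC : commutative linHom_add.
Proof. by move=> f g; apply: linHomP => x; apply: addrC. Qed.
Fact linHom_add0 : left_id linHom_zero linHom_add.
Proof. by move=> f; apply: linHomP => x; apply: add0r. Qed.
Fact linHom_addN : left_inverse linHom_zero linHom_opp linHom_add.
Proof. by move=> f; apply: linHomP => x; apply: addNr. Qed.

HB.instance Definition _ :=
  GRing.isZmodule.Build linHom linHom_addA linHom_addC linHom_add0 linHom_addN.

Fact linHom_scaleA a b f :
  linHom_scale a (linHom_scale b f) = linHom_scale (a * b) f.
Proof. by apply: linHomP => x; apply: scalerA. Qed.
Fact linHom_scale1 : left_id 1 linHom_scale.
Proof. by move=> f; apply: linHomP => x; apply: scale1r. Qed.
Fact linHom_scaleDr : right_distributive linHom_scale +%R.
Proof. by move=> a f g; apply: linHomP => x; apply: scalerDr. Qed.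
Fact linHom_scaleDl f : {morph linHom_scale^~ f : a b / a + b}.
Proof. by move=> a b; apply: linHomP => x; apply: scalerDl. Qed.

HB.instance Definition _ :=
  GRing.Zmodule_isLmodule.Build R linHom linHom_scaleA linHom_scale1
    linHom_scaleDr linHom_scaleDl.

Lemma linHom_appD (f g : linHom) x :
  linHom_app (f + g) x = linHom_app f x + linHom_app g x.
Proof. by []. Qed.

Lemma linHom_appZ a (f : linHom) x : linHom_app (a *: f) x = a *: linHom_app f x.
Proof. by []. Qed.

End LinHom.

Definition dual (R : comPzRingType) (N : lmodType R) : lmodType R :=
  linHom N R^o.

Section DualMap.
Variables (R : comPzRingType) (N N' : lmodType R) (u : {linear N -> N'}).

Fact dual_map_subproof (w : dual N') : linear (fun x => linHom_app w (u x)).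
Proof. by move=> a x y; rewrite linearP linHom_linear. Qed.

Definition dual_map (w : dual N') : dual N := linHom_of (dual_map_subproof w).

Fact dual_map_linear : linear dual_map.
Proof. by move=> a v w; apply: linHomP. Qed.

HB.instance Definition _ :=
  GRing.isLinear.Build R (dual N') (dual N) *:%R dual_map dual_map_linear.

End DualMap.

(* The alias separates the A-module structure of Hom_R(U, A) from its R-module
   structure, which is keyed on [linHom].                                     *)
Section HomAlg.
Variables (R : comPzRingType) (U : lmodType R) (A : comAlg R).

Definition homAlg : Type := linHom U (algMod A).

HB.instance Definition _ := GRing.Zmodule.on homAlg.

Fact homAlg_scale_linear (a : A) (f : homAlg) :
  linear (fun x => alg_mul a (linHom_app f x)).
Proof. by move=> b x y; rewrite linHom_linear linearP. Qed.

Definition homAlg_scale (a : A) (f : homAlg) : homAlg :=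
  linHom_of (homAlg_scale_linear a f).

Fact homAlg_scaleA a b f :
  homAlg_scale a (homAlg_scale b f) = homAlg_scale (a * b) f.
Proof. by apply: linHomP => x; apply: mulrA. Qed.
Fact homAlg_scale1 : left_id 1 homAlg_scale.
Proof. by move=> f; apply: linHomP => x; apply: mul1r. Qed.
Fact homAlg_scaleDr : right_distributive homAlg_scale +%R.
Proof. by move=> a f g; apply: linHomP => x; apply: mulrDr. Qed.
Fact homAlg_scaleDl f : {morph homAlg_scale^~ f : a b / a + b}.
Proof. by move=> a b; apply: linHomP => x; apply: mulrDl. Qed.

HB.instance Definition _ :=
  GRing.Zmodule_isLmodule.Build A homAlg homAlg_scaleA homAlg_scale1
    homAlg_scaleDr homAlg_scaleDl.

Lemma homAlg_appZ (a : A) (f : homAlg) x :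
  linHom_app (a *: f) x = a * (linHom_app f x : A) :> A.
Proof. by []. Qed.

End HomAlg.

Section Sch.
Variables (R : comPzRingType) (N : lmodType R).

Fact sch_map_subproof (A B : comAlg R) (f : algHom A B) (h : homAlg (dual N) A) :
  linear (fun w => algHom_mod f (linHom_app h w)).
Proof. by move=> a v w; rewrite linHom_linear linearP. Qed.

Definition sch_map (A B : comAlg R) (f : algHom A B) (h : homAlg (dual N) A) :
  homAlg (dual N) B := linHom_of (sch_map_subproof f h).

Fact sch_map_id A h : sch_map (algHom_id A) h = h.
Proof. exact: linHomP. Qed.

Fact sch_map_comp A B C (g : algHom B C) (f : algHom A B) h :
  sch_map (algHom_comp g f) h = sch_map g (sch_map f h).
Proof. exact: linHomP. Qed.

Fact sch_mapD A B (f : algHom A B) (h k : homAlg (dual N) A) :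
  sch_map f (h + k) = sch_map f h + sch_map f k.
Proof. by apply: linHomP => w; apply: linearD. Qed.

Fact sch_mapZ A B (f : algHom A B) (a : A) (h : homAlg (dual N) A) :
  sch_map f (a *: h) = f a *: sch_map f h.
Proof. by apply: linHomP => w; apply: rmorphM. Qed.

Definition sch : Rmod R := MkRmod sch_map_id sch_map_comp sch_mapD sch_mapZ.

End Sch.

Section SchHom.
Variables (R : comPzRingType) (N N' : lmodType R) (u : {linear N -> N'}).

Fact sch_hom_subproof (A : comAlg R) (h : sch N A) :
  linear (fun w : dual N' => linHom_app h (dual_map u w)).
Proof. by move=> a v w; rewrite linearP linHom_linear. Qed.

Definition sch_hom_fun (A : comAlg R) (h : sch N A) : sch N' A :=
  linHom_of (sch_hom_subproof h).

Fact sch_hom_linear A : linear (@sch_hom_fun A).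
Proof. by move=> a h k; apply: linHomP. Qed.

HB.instance Definition _ (A : comAlg R) :=
  GRing.isLinear.Build A (sch N A) (sch N' A) *:%R (@sch_hom_fun A)
    (@sch_hom_linear A).

Fact sch_hom_nat A B (f : algHom A B) (h : sch N A) :
  sch_hom_fun (fmap (sch N) f h) = fmap (sch N') f (sch_hom_fun h).
Proof. exact: linHomP. Qed.

Definition sch_hom : RmodHom (sch N) (sch N') :=
  @MkRmodHom R (sch N) (sch N') (fun A => @sch_hom_fun A : {linear _ -> _})
    sch_hom_nat.

End SchHom.

(* The natural morphism, sending n (x) r to the map w |-> w(n) r. *)
Section ToSch.
Variables (R : comPzRingType) (N : lmodType R).

Fact eval_linear (A : comAlg R) (n : N) (r : algMod A) :
  linear (fun w : dual N => (linHom_app w n : R) *: r).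
Proof. by move=> a v w; rewrite linHom_appD linHom_appZ scalerDl scalerA. Qed.

Definition to_sch_tens (A : comAlg R) (n : N) (r : algMod A) : sch N A :=
  linHom_of (eval_linear n r).

Lemma to_sch_tensE (A : comAlg R) (n : N) (r : algMod A) (w : dual N) :
  linHom_app (to_sch_tens n r) w = (linHom_app w n : R) *: r.
Proof. by []. Qed.

Fact to_sch_balanced (A : comAlg R) : balanced (@to_sch_tens A).
Proof.
split=> [x y r|x r s|a x r]; apply: linHomP => w.
- by rewrite linHom_appD !to_sch_tensE linHomD scalerDl.
- by rewrite linHom_appD !to_sch_tensE scalerDr.
- by rewrite !to_sch_tensE linHomZ scalerA [_ * a]mulrC.
Qed.

Definition to_sch_fun (A : comAlg R) : qcoh N A -> sch N A :=
  tens_desc (@to_sch_tens A).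

Fact to_sch_funE A n r : @to_sch_fun A (tens n r) = to_sch_tens n r.
Proof. exact: tens_descE (@to_sch_balanced A) _ _. Qed.

Fact to_sch_funD A : {morph @to_sch_fun A : t u / t + u}.
Proof. exact: tens_descD (@to_sch_balanced A). Qed.

Fact to_sch_linear A : linear (@to_sch_fun A).
Proof.
move=> a t u; rewrite to_sch_funD; congr (_ + _).
move: t; apply: tensor_ext => [t t'|t t'|x r].
- by rewrite scalerDr to_sch_funD.
- by rewrite to_sch_funD scalerDr.
- rewrite baseChangeZ !to_sch_funE; apply: linHomP => w.
  by rewrite homAlg_appZ !to_sch_tensE; apply: mulrCA.
Qed.

HB.instance Definition _ (A : comAlg R) :=
  GRing.isLinear.Build A (qcoh N A) (sch N A) *:%R (@to_sch_fun A)
    (@to_sch_linear A).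

Fact to_sch_nat A B (f : algHom A B) (t : qcoh N A) :
  to_sch_fun (fmap (qcoh N) f t) = fmap (sch N) f (to_sch_fun t).
Proof.
move: t; apply: tensor_ext.
- by move=> t t'; rewrite fmapD to_sch_funD.
- by move=> t t'; rewrite to_sch_funD fmapD.
move=> x r; rewrite /= qcoh_map_tens !to_sch_funE; apply: linHomP => w.
rewrite to_sch_tensE; apply/esym; exact: linearZ.
Qed.

Definition to_sch : RmodHom (qcoh N) (sch N) :=
  @MkRmodHom R (qcoh N) (sch N) (fun A => @to_sch_fun A : {linear _ -> _})
    to_sch_nat.

End ToSch.

Record dirset := DirSet {
  dir_sort :> Type;
  dir_le : dir_sort -> dir_sort -> Prop;
  dir_refl : forall i, dir_le i i;
  dir_trans : forall j i k, dir_le i j -> dir_le j k -> dir_le i k;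
  dir_ub : forall i j, exists k, dir_le i k /\ dir_le j k;
  dir_inh : inhabited dir_sort
}.

Record modSys (K : pzRingType) (I : dirset) := ModSys {
  sys_obj :> I -> lmodType K;
  sys_map : forall i j, dir_le i j -> {linear sys_obj i -> sys_obj j};
  sys_id : forall i (h : dir_le i i) x, sys_map h x = x;
  sys_comp : forall i j k (hij : dir_le i j) (hjk : dir_le j k)
    (hik : dir_le i k) x, sys_map hjk (sys_map hij x) = sys_map hik x
}.

Section Colim.
Variables (K : pzRingType) (I : dirset) (S : modSys K I).

Definition colim_pre : Type := {classic {i : I & S i}}.
Definition colim_in_pre (i : I) (x : S i) : colim_pre := existT _ i x.

Definition colim_eq (p q : colim_pre) : Prop :=
  exists k (hp : dir_le (projT1 p) k) (hq : dir_le (projT1 q) k),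
    sys_map S hp (projT2 p) = sys_map S hq (projT2 q).

Definition colim_eqb (p q : colim_pre) : bool := `[< colim_eq p q >].

Fact colim_eqb_refl : reflexive colim_eqb.
Proof. by move=> p; apply/asboolP; exists (projT1 p), (dir_refl _), (dir_refl _). Qed.

Fact colim_eqb_sym : symmetric colim_eqb.
Proof.
by move=> p q; apply/asboolP/asboolP => -[k [hp [hq e]]]; exists k, hq, hp.
Qed.

Fact colim_eqb_trans : transitive colim_eqb.
Proof.
move=> q p r /asboolP[k [hp [hq e]]] /asboolP[l [hq' [hr e']]]; apply/asboolP.
have [m [km lm]] := dir_ub k l.
exists m, (dir_trans hp km), (dir_trans hr lm).
rewrite -(sys_comp hp km) e -(sys_comp hr lm) -e'.
by rewrite (sys_comp hq km (dir_trans hq km)) (sys_comp hq' lm (dir_trans hq km)).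
Qed.

Canonical colim_equiv :=
  EquivRel colim_eqb colim_eqb_refl colim_eqb_sym colim_eqb_trans.

Definition colim : Type := {eq_quot colim_equiv}.

HB.instance Definition _ := Choice.on colim.
HB.instance Definition _ := EqQuotient.on colim.

Definition colim_in (i : I) (x : S i) : colim := \pi_colim (colim_in_pre x).

Lemma colim_inP i j (x : S i) (y : S j) :
  colim_in x = colim_in y <->
  exists k (hi : dir_le i k) (hj : dir_le j k), sys_map S hi x = sys_map S hj y.
Proof. by split => [/eqmodP/asboolP//|h]; apply/eqmodP/asboolP. Qed.

Lemma colim_in_map i j (h : dir_le i j) (x : S i) :
  colim_in (sys_map S h x) = colim_in x.
Proof.
apply/colim_inP; exists j, (dir_refl j), h.
by rewrite sys_id.
Qed.

Lemma colimW (t : colim) : exists i (x : S i), t = colim_in x.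
Proof. by elim/quotW: t => -[i x]; exists i, x. Qed.

Lemma colimW2 (t u : colim) :
  exists i (x y : S i), t = colim_in x /\ u = colim_in y.
Proof.
have [[i [x ->]] [j [y ->]]] := (colimW t, colimW u).
have [k [ik jk]] := dir_ub i j.
by exists k, (sys_map S ik x), (sys_map S jk y); rewrite !colim_in_map.
Qed.

Lemma colimW3 (t u v : colim) : exists i (x y z : S i),
  [/\ t = colim_in x, u = colim_in y & v = colim_in z].
Proof.
have [[i [x [y [-> ->]]]] [j [z ->]]] := (colimW2 t u, colimW v).
have [k [ik jk]] := dir_ub i j.
exists k, (sys_map S ik x), (sys_map S ik y), (sys_map S jk z).
by rewrite !colim_in_map.
Qed.

Fact dir_inh_ex : exists _ : I, True.
Proof. by have [i] := dir_inh I; exists i. Qed.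

Definition colim_zero : colim := colim_in (0 : S (projT1 (cid dir_inh_ex))).

Definition colim_add (t u : colim) : colim :=
  let: exist k (conj ht hu) := cid (dir_ub (projT1 (repr t)) (projT1 (repr u))) in
  colim_in (sys_map S ht (projT2 (repr t)) + sys_map S hu (projT2 (repr u))).

Definition colim_opp (t : colim) : colim := colim_in (- projT2 (repr t)).

Definition colim_scale (a : K) (t : colim) : colim :=
  colim_in (a *: projT2 (repr t)).

Fact colim_repr (t : colim) : colim_in (projT2 (repr t)) = t.
Proof.
by rewrite -[RHS]reprK /colim_in /colim_in_pre; case: (repr t).
Qed.

Fact colim_zero_in i : colim_zero = colim_in (0 : S i).
Proof.
have [k [h h']] := dir_ub (projT1 (cid dir_inh_ex)) i.
by apply/colim_inP; exists k, h, h'; rewrite !linear0.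
Qed.

Fact colim_opp_in i (x : S i) : colim_opp (colim_in x) = colim_in (- x).
Proof.
have /colim_inP[k [h [h' e]]] := colim_repr (colim_in x).
by apply/colim_inP; exists k, h, h'; rewrite !linearN e.
Qed.

Fact colim_scale_in a i (x : S i) :
  colim_scale a (colim_in x) = colim_in (a *: x).
Proof.
have /colim_inP[k [h [h' e]]] := colim_repr (colim_in x).
by apply/colim_inP; exists k, h, h'; rewrite !linearZ_LR e.
Qed.

Fact colim_add_in i (x y : S i) :
  colim_add (colim_in x) (colim_in y) = colim_in (x + y).
Proof.
rewrite /colim_add; case: cid => k [/= hx hy].
have /colim_inP[l [lx [il ex]]] := colim_repr (colim_in x).
have /colim_inP[m [my [im ey]]] := colim_repr (colim_in y).
have [n1 [ln1 mn1]] := dir_ub l m; have [n [n1n kn]] := dir_ub n1 k.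
have ln := dir_trans ln1 n1n; have mn := dir_trans mn1 n1n.
have i_n := dir_trans il ln.
have ex' : sys_map S kn (sys_map S hx (projT2 (repr (colim_in x)))) =
           sys_map S i_n x.
  rewrite (sys_comp hx kn (dir_trans lx ln)) -(sys_comp lx ln) ex.
  exact: sys_comp.
have ey' : sys_map S kn (sys_map S hy (projT2 (repr (colim_in y)))) =
           sys_map S i_n y.
  rewrite (sys_comp hy kn (dir_trans my mn)) -(sys_comp my mn) ey.
  exact: sys_comp.
apply/colim_inP; exists n, kn, i_n.
by rewrite !linearD ex' ey'.
Qed.

Fact colim_addA : associative colim_add.
Proof.
move=> t u v; have [i [x [y [z [-> -> ->]]]]] := colimW3 t u v.
by rewrite !colim_add_in addrA.
Qed.

Fact colim_addC : commutative colim_add.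
Proof.
move=> t u; have [i [x [y [-> ->]]]] := colimW2 t u.
by rewrite !colim_add_in addrC.
Qed.

Fact colim_add0 : left_id colim_zero colim_add.
Proof.
move=> t; have [i [x ->]] := colimW t.
by rewrite (colim_zero_in i) colim_add_in add0r.
Qed.

Fact colim_addN : left_inverse colim_zero colim_opp colim_add.
Proof.
move=> t; have [i [x ->]] := colimW t.
by rewrite colim_opp_in colim_add_in addNr -colim_zero_in.
Qed.

HB.instance Definition _ :=
  GRing.isZmodule.Build colim colim_addA colim_addC colim_add0 colim_addN.

Fact colim_scaleA a b t : colim_scale a (colim_scale b t) = colim_scale (a * b) t.
Proof.
by have [i [x ->]] := colimW t; rewrite !colim_scale_in scalerA.
Qed.

Fact colim_scale1 : left_id 1 colim_scale.
Proof.
by move=> t; have [i [x ->]] := colimW t; rewrite colim_scale_in scale1r.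
Qed.

Fact colim_scaleDr : right_distributive colim_scale +%R.
Proof.
move=> a t u; have [i [x [y [-> ->]]]] := colimW2 t u.
by rewrite [_ + _]colim_add_in !colim_scale_in [RHS]colim_add_in scalerDr.
Qed.

Fact colim_scaleDl t : {morph colim_scale^~ t : a b / a + b}.
Proof.
move=> a b; have [i [x ->]] := colimW t.
by rewrite !colim_scale_in [RHS]colim_add_in scalerDl.
Qed.

HB.instance Definition _ :=
  GRing.Zmodule_isLmodule.Build K colim colim_scaleA colim_scale1
    colim_scaleDr colim_scaleDl.

Fact colim_in_linear i : linear (@colim_in i).
Proof.
move=> a x y.
by rewrite [_ *: colim_in x]colim_scale_in [RHS]colim_add_in.
Qed.

HB.instance Definition _ i :=
  GRing.isLinear.Build K (S i) colim *:%R (@colim_in i) (@colim_in_linear i).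

Definition colim_desc (T : Type) (f : forall i, S i -> T) (t : colim) : T :=
  f (projT1 (repr t)) (projT2 (repr t)).

Lemma colim_descE (T : Type) (f : forall i, S i -> T) :
    (forall i j (h : dir_le i j) x, f j (sys_map S h x) = f i x) ->
  forall i x, colim_desc f (@colim_in i x) = f i x.
Proof.
move=> fP i x; have /colim_inP[k [h [h' e]]] := colim_repr (colim_in x).
by rewrite /colim_desc -(fP _ _ h) e fP.
Qed.

End Colim.
Arguments colim_in {K I} S {i} x.

Record RmodSys (R : comPzRingType) (I : dirset) := MkRmodSys {
  Fobj :> I -> Rmod R;
  Fmap : forall i j, dir_le i j -> RmodHom (Fobj i) (Fobj j);
  Fmap_id : forall i (h : dir_le i i) A (x : Fobj i A), Fmap h A x = x;
  Fmap_comp : forall i j k (hij : dir_le i j) (hjk : dir_le j k)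
    (hik : dir_le i k) A (x : Fobj i A),
    Fmap hjk A (Fmap hij A x) = Fmap hik A x
}.

Section RmodColim.
Variables (R : comPzRingType) (I : dirset) (F : RmodSys R I).

Definition sys_at (A : comAlg R) : modSys A I :=
  @ModSys A I (fun i => F i A) (fun i j h => Fmap F h A)
    (fun i h => @Fmap_id R I F i h A)
    (fun i j k hij hjk hik => @Fmap_comp R I F i j k hij hjk hik A).

Definition Fcolim_map (A B : comAlg R) (f : algHom A B) :
    colim (sys_at A) -> colim (sys_at B) :=
  colim_desc (fun i (x : sys_at A i) => colim_in (sys_at B) (fmap (F i) f x)).

Fact Fcolim_map_in A B (f : algHom A B) i (x : F i A) :
  Fcolim_map f (colim_in (sys_at A) x) = colim_in (sys_at B) (fmap (F i) f x).
Proof.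
rewrite /Fcolim_map colim_descE // => {x}i j h x.
by rewrite /= -hom_nat; apply: (colim_in_map (S := sys_at B)).
Qed.

Fact Fcolim_map_id A (t : colim (sys_at A)) : Fcolim_map (algHom_id A) t = t.
Proof. by have [i [x ->]] := colimW t; rewrite Fcolim_map_in fmap_id. Qed.

Fact Fcolim_map_comp A B C (g : algHom B C) (f : algHom A B)
    (t : colim (sys_at A)) :
  Fcolim_map (algHom_comp g f) t = Fcolim_map g (Fcolim_map f t).
Proof. by have [i [x ->]] := colimW t; rewrite !Fcolim_map_in fmap_comp. Qed.

Fact Fcolim_mapD A B (f : algHom A B) (t u : colim (sys_at A)) :
  Fcolim_map f (t + u) = Fcolim_map f t + Fcolim_map f u.
Proof.
have [i [x [y [-> ->]]]] := colimW2 t u.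
by rewrite -linearD !Fcolim_map_in -linearD -fmapD.
Qed.

Fact Fcolim_mapZ A B (f : algHom A B) (a : A) (t : colim (sys_at A)) :
  Fcolim_map f (a *: t) = f a *: Fcolim_map f t.
Proof.
have [i [x ->]] := colimW t.
by rewrite -linearZ !Fcolim_map_in -linearZ -fmapZ.
Qed.

Definition Fcolim : Rmod R :=
  MkRmod Fcolim_map_id Fcolim_map_comp Fcolim_mapD Fcolim_mapZ.

End RmodColim.

Section RmodColimHom.
Variables (R : comPzRingType) (I : dirset) (F G : RmodSys R I).
Variable u : forall i, RmodHom (F i) (G i).
Hypothesis u_nat : forall i j (h : dir_le i j) A (x : F i A),
  u j A (Fmap F h A x) = Fmap G h A (u i A x).

Definition Fcolim_hom_fun (A : comAlg R) : Fcolim F A -> Fcolim G A :=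
  colim_desc (fun i (x : sys_at F A i) => colim_in (sys_at G A) (u i A x)).

Fact Fcolim_hom_in A i (x : F i A) :
  Fcolim_hom_fun (colim_in (sys_at F A) x) = colim_in (sys_at G A) (u i A x).
Proof.
rewrite /Fcolim_hom_fun colim_descE // => {x}i j h x.
by rewrite /= u_nat; apply: (colim_in_map (S := sys_at G A)).
Qed.

Fact Fcolim_hom_linear A : linear (@Fcolim_hom_fun A).
Proof.
move=> a t t'; have [i [x [y [-> ->]]]] := colimW2 t t'.
by rewrite -linearP !Fcolim_hom_in -linearP -linearP.
Qed.

HB.instance Definition _ (A : comAlg R) :=
  GRing.isLinear.Build A (Fcolim F A) (Fcolim G A) *:%R (@Fcolim_hom_fun A)
    (@Fcolim_hom_linear A).

Fact Fcolim_hom_nat A B (f : algHom A B) (t : Fcolim F A) :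
  Fcolim_hom_fun (fmap (Fcolim F) f t) = fmap (Fcolim G) f (Fcolim_hom_fun t).
Proof.
have [i [x ->]] := colimW t.
rewrite Fcolim_hom_in.
rewrite [fmap (Fcolim F) f _]Fcolim_map_in [RHS]Fcolim_map_in Fcolim_hom_in.
by rewrite hom_nat.
Qed.

Definition Fcolim_hom : RmodHom (Fcolim F) (Fcolim G) :=
  @MkRmodHom R (Fcolim F) (Fcolim G)
    (fun A => @Fcolim_hom_fun A : {linear _ -> _}) Fcolim_hom_nat.

End RmodColimHom.

Section FgSystems.
Variables (R : comPzRingType) (M : lmodType R).

Fact subfg_refl (S : fgSubmod M) : subfg S S.
Proof. by []. Qed.

Fact subfg_trans (T S U : fgSubmod M) : subfg S T -> subfg T U -> subfg S U.
Proof. by move=> ST TU x /ST/TU. Qed.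

Definition fg_dirset : dirset :=
  DirSet subfg_refl subfg_trans (@subfg_directed R M)
    (inhabits (fgSubmod_span [::])).

Fact submod_incl_id (S : fgSubmod M) (h : subfg S S) x : submod_incl h x = x.
Proof. exact: val_inj. Qed.

Fact submod_incl_comp (S T U : fgSubmod M) (ST : subfg S T) (TU : subfg T U)
  (SU : subfg S U) x : submod_incl TU (submod_incl ST x) = submod_incl SU x.
Proof. exact: val_inj. Qed.

Definition incl (S T : fgSubmod M) (ST : subfg S T) :
  {linear submod S -> submod T} := submod_incl ST.

Fact qcoh_sys_id (S : fg_dirset) (h : dir_le S S) A (t : qcoh (submod S) A) :
  qcoh_hom (incl h) A t = t.
Proof.
move: t; apply: tensor_ext => //; first exact: qcoh_homD.
by move=> x r; rewrite /= qcoh_hom_tens /= submod_incl_id.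
Qed.

Fact qcoh_sys_comp (S T U : fg_dirset) (ST : dir_le S T) (TU : dir_le T U)
    (SU : dir_le S U) A (t : qcoh (submod S) A) :
  qcoh_hom (incl TU) A (qcoh_hom (incl ST) A t) = qcoh_hom (incl SU) A t.
Proof.
move: t; apply: tensor_ext; try by move=> t u; rewrite !linearD.
by move=> x r; rewrite /= !qcoh_hom_tens /= submod_incl_comp.
Qed.

Definition qcoh_sys : RmodSys R fg_dirset := MkRmodSys qcoh_sys_id qcoh_sys_comp.

Fact sch_sys_id (S : fg_dirset) (h : dir_le S S) A (k : sch (submod S) A) :
  sch_hom (incl h) A k = k.
Proof.
apply: linHomP => w; congr (linHom_app k _); apply: linHomP => x.
by congr (linHom_app w _); apply: submod_incl_id.
Qed.

Fact sch_sys_comp (S T U : fg_dirset) (ST : dir_le S T) (TU : dir_le T U)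
    (SU : dir_le S U) A (k : sch (submod S) A) :
  sch_hom (incl TU) A (sch_hom (incl ST) A k) = sch_hom (incl SU) A k.
Proof.
apply: linHomP => w; congr (linHom_app k _); apply: linHomP => x.
by congr (linHom_app w _); apply: submod_incl_comp.
Qed.

Definition sch_sys : RmodSys R fg_dirset := MkRmodSys sch_sys_id sch_sys_comp.

Fact to_sch_sys_nat (S T : fg_dirset) (ST : dir_le S T) A (t : qcoh_sys S A) :
  to_sch (submod T) A (Fmap qcoh_sys ST A t) =
  Fmap sch_sys ST A (to_sch (submod S) A t).
Proof.
move: t; apply: tensor_ext; try by move=> t u; rewrite !linearD.
move=> x r; rewrite /= qcoh_hom_tens !to_sch_funE.
exact: linHomP.
Qed.

Definition colim_to_sch : RmodHom (Fcolim qcoh_sys) (Fcolim sch_sys) :=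
  @Fcolim_hom R fg_dirset qcoh_sys sch_sys
    (fun S : fg_dirset => to_sch (submod S)) to_sch_sys_nat.

(* The identification of the direct limit of the M_i with M: the canonical
   morphism out of the limit, and its inverse, sending x (x) r to the class of
   x (x) r in <x> (x) A.                                                      *)

Definition from_fg_fun (A : comAlg R) : Fcolim qcoh_sys A -> qcoh M A :=
  colim_desc (fun (S : fg_dirset) (t : sys_at qcoh_sys A S) =>
    qcoh_hom (submod_val (S := S) : {linear submod S -> M}) A t).

Fact from_fg_in A (S : fg_dirset) (t : qcoh (submod S) A) :
  from_fg_fun (colim_in (sys_at qcoh_sys A) (i := S) t) =
  qcoh_hom (submod_val (S := S) : {linear submod S -> M}) A t.
Proof.
rewrite /from_fg_fun colim_descE // => {S t}S T ST.
apply: tensor_ext; try by move=> t u; rewrite !linearD.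
by move=> x r; rewrite /= !qcoh_hom_tens.
Qed.

Definition in_span (x : M) : submod (fgSubmod_span [:: x]) :=
  Sub x (span_seq_mem (mem_head x [::])).

Definition to_fg_tens (A : comAlg R) (x : M) (r : algMod A) :
    Fcolim qcoh_sys A :=
  colim_in (sys_at qcoh_sys A) (i := fgSubmod_span [:: x] : fg_dirset)
    (tens (in_span x) r : qcoh _ A).

Fact to_fg_tensE A (S : fg_dirset) (x : submod S) (r : algMod A) :
  to_fg_tens (submod_val x) r =
  colim_in (sys_at qcoh_sys A) (i := S) (tens x r : qcoh _ A).
Proof.
have sub : subfg (fgSubmod_span [:: submod_val x]) S.
  move=> y /span_seq_min; apply=> z; rewrite inE => /eqP->.
  exact: (valP x).
rewrite /to_fg_tens -(colim_in_map (S := sys_at qcoh_sys A) sub) /=.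
by rewrite qcoh_hom_tens; congr colim_in; congr (tens _ r); apply: val_inj.
Qed.

Fact to_fg_balanced A : balanced (@to_fg_tens A).
Proof.
split=> [x y r|x r s|a x r].
- pose S := fgSubmod_span [:: x; y].
  have Sx : x \in fg_mem S by apply: span_seq_mem; rewrite inE eqxx.
  have Sy : y \in fg_mem S by apply: span_seq_mem; rewrite !inE eqxx orbT.
  pose x' : submod S := Sub x Sx; pose y' : submod S := Sub y Sy.
  have := @to_fg_tensE A S (x' + y') r; rewrite tensDl [RHS]linearD.
  by move=> ->; congr (_ + _);
    [exact: esym (to_fg_tensE x' r) | exact: esym (to_fg_tensE y' r)].
- by rewrite /to_fg_tens tensDr linearD.
- by have := @to_fg_tensE A _ (a *: in_span x) r; rewrite tensZ.
Qed.

Definition to_fg_fun (A : comAlg R) : qcoh M A -> Fcolim qcoh_sys A :=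
  tens_desc (@to_fg_tens A).

Fact to_fg_funE A x r : @to_fg_fun A (tens x r) = to_fg_tens x r.
Proof. exact: tens_descE (@to_fg_balanced A) _ _. Qed.

Fact to_fg_funD A : {morph @to_fg_fun A : t u / t + u}.
Proof. exact: tens_descD (@to_fg_balanced A). Qed.

Fact to_fg_linear A : linear (@to_fg_fun A).
Proof.
move=> a t u; rewrite to_fg_funD; congr (_ + _).
move: t; apply: tensor_ext => [t t'|t t'|x r].
- by rewrite scalerDr to_fg_funD.
- by rewrite to_fg_funD scalerDr.
- by rewrite baseChangeZ !to_fg_funE /to_fg_tens -linearZ baseChangeZ.
Qed.

HB.instance Definition _ (A : comAlg R) :=
  GRing.isLinear.Build A (qcoh M A) (Fcolim qcoh_sys A) *:%R (@to_fg_fun A)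
    (@to_fg_linear A).

Fact to_fg_nat A B (f : algHom A B) (t : qcoh M A) :
  to_fg_fun (fmap (qcoh M) f t) = fmap (Fcolim qcoh_sys) f (to_fg_fun t).
Proof.
move: t; apply: tensor_ext.
- by move=> t t'; rewrite fmapD to_fg_funD.
- by move=> t t'; rewrite to_fg_funD fmapD.
move=> x r; rewrite /= qcoh_map_tens !to_fg_funE Fcolim_map_in /=.
by rewrite qcoh_map_tens.
Qed.

Definition to_fg : RmodHom (qcoh M) (Fcolim qcoh_sys) :=
  @MkRmodHom R (qcoh M) (Fcolim qcoh_sys)
    (fun A => @to_fg_fun A : {linear _ -> _}) to_fg_nat.

Fact from_fg_linear A : linear (@from_fg_fun A).
Proof.
move=> a t u; have [S [x [y [-> ->]]]] := colimW2 t u.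
by rewrite -linearP !from_fg_in linearP.
Qed.

HB.instance Definition _ (A : comAlg R) :=
  GRing.isLinear.Build A (Fcolim qcoh_sys A) (qcoh M A) *:%R (@from_fg_fun A)
    (@from_fg_linear A).

Fact from_fg_nat A B (f : algHom A B) (t : Fcolim qcoh_sys A) :
  from_fg_fun (fmap (Fcolim qcoh_sys) f t) = fmap (qcoh M) f (from_fg_fun t).
Proof.
have [S [x ->]] := colimW t.
rewrite [fmap (Fcolim _) f _]Fcolim_map_in !from_fg_in.
exact: (hom_nat (qcoh_hom (submod_val (S := S) : {linear submod S -> M}))).
Qed.

Definition from_fg : RmodHom (Fcolim qcoh_sys) (qcoh M) :=
  @MkRmodHom R (Fcolim qcoh_sys) (qcoh M)
    (fun A => @from_fg_fun A : {linear _ -> _}) from_fg_nat.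

Lemma to_fgK A : cancel (to_fg A) (from_fg A).
Proof.
apply: tensor_ext => //; first by move=> t u; rewrite !linearD.
by move=> x r; rewrite /= to_fg_funE from_fg_in /= qcoh_hom_tens.
Qed.

Lemma from_fgK A : cancel (from_fg A) (to_fg A).
Proof.
move=> t; have [S [x ->]] := colimW t; rewrite /= from_fg_in.
move: x; apply: tensor_ext; try by move=> x y; rewrite !linearD.
by move=> x r; rewrite /= qcoh_hom_tens to_fg_funE to_fg_tensE.
Qed.

Lemma from_fg_iso : RmodIso from_fg.
Proof. by exists to_fg; split; [exact: from_fgK | exact: to_fgK]. Qed.

(* The natural morphism M = lim M_i -> lim M_{i,sch}. *)
Definition natural_to_sch : RmodHom (qcoh M) (Fcolim sch_sys) :=
  RmodHom_comp colim_to_sch to_fg.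

Lemma natural_to_schE A x (r : algMod A) :
  natural_to_sch A (tens x r) =
  colim_in (sys_at sch_sys A) (i := fgSubmod_span [:: x] : fg_dirset)
    (to_sch_tens (in_span x) r).
Proof.
rewrite /= to_fg_funE.
have := @Fcolim_hom_in R fg_dirset qcoh_sys sch_sys _ to_sch_sys_nat A
  (fgSubmod_span [:: x]) (tens (in_span x) r).
by rewrite /= to_sch_funE.
Qed.

End FgSystems.

(* Main.v *)
(* Both conditions are equivalent to the existence, for every finitely generated
   submodule S of M, of finitely many phi_l in S^* and y_l in M such that
   x = sum_l phi_l(x) y_l for all x in S. Flatness gives them because the module
   of relations between generators of S is finitely generated. Given them, the
   inverse of the natural morphism sends the class of k : S^* -> A to
   sum_l y_l (x) k(phi_l). Conversely, if the natural morphism is an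
   isomorphism, its value at the square-zero extension of R by S^* provides the
   phi_l and y_l. Finally, an element of M (x) N killed in M (x) N'' is killed
   in S (x) N'' for some S, and can then be rewritten as sum_l y_l (x) n_l with
   all n_l in the kernel of N -> N''. *)
Require Import Defs.
From HB Require Import structures.
From mathcomp Require Import all_boot all_order all_algebra.
From mathcomp Require Import boolp.

Set Implicit Arguments.
Unset Strict Implicit.
Unset Printing Implicit Defensive.

Import GRing.Theory.
Local Open Scope ring_scope.

(** * Noetherian modules and free modules of finite rank *)

Section NoetherianModules.
Variable R : comPzRingType.

(** Submodules are given as predicates, so that images and preimages under linear maps need no
    packaging. *)
Definition noetherian_module (V : lmodType R) : Prop :=
  forall P : V -> Prop, P 0 -> (forall a x y, P x -> P y -> P (a *: x + y)) ->
  exists s : seq V, (forall x, x \in s -> P x) /\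
    (forall x, P x -> exists c : nat -> R, x = \sum_(i < size s) c i *: s`_i).

Lemma noetherian_regular : noetherian R -> noetherian_module R^o.
Proof.
move=> hR P P0 PD; pose I : pred R^o := fun x => `[< P x >].
have IC : subsemimod_closed I.
  split; first split; first exact/asboolP.
  - move=> x y /asboolP Px /asboolP Py; apply/asboolP.
    by rewrite -[x]scale1r; apply: PD.
  - by move=> a x /asboolP Px; apply/asboolP; rewrite -[_ *: _]addr0; apply: PD.
pose IH := GRing.isSubmodClosed.Build R R^o I IC.
pose J : submodClosed R^o := HB.pack I IH.
have [s Js] := hR J; exists s; split=> x.
  by move=> /span_seq_mem; rewrite -Js => /asboolP.
move=> Px; have : x \in J by apply/asboolP.
by rewrite Js => /asboolP.
Qed.

(** Generators of a submodule are lifts of generators of its image in V'', together with the images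
    of generators of its preimage in V'. *)
Lemma noetherian_module_ext (V' V V'' : lmodType R)
    (f : {linear V' -> V}) (g : {linear V -> V''}) :
  exact_at f g -> noetherian_module V' -> noetherian_module V'' ->
  noetherian_module V.
Proof.
move=> fg N' N'' P P0 PD.
have Psum (I : Type) (r : seq I) (F : I -> V) (c : I -> R) :
    (forall i, P (F i)) -> P (\sum_(i <- r) c i *: F i).
  by move=> PF; elim: r => [|i r IHr]; rewrite ?big_nil // big_cons; apply: PD.
have [||s'' [Ps'' gen'']] := N'' (fun z => exists2 x, P x & g x = z).
- by exists 0 => //; rewrite linear0.
- move=> a _ _ [x Px <-] [y Py <-]; exists (a *: x + y); first exact: PD.
  by rewrite linearP.
have [||s' [Ps' gen']] := N' (fun z => P (f z)).
- by rewrite linear0.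
- by move=> a x y Px Py; rewrite linearP; apply: PD.
have [t [Pt gt]] : exists t : nat -> V,
    (forall i, P (t i)) /\ (forall i, (i < size s'')%N -> g (t i) = s''`_i).
  (* Indices out of range get 0, so that [P (t i)] holds for every [i]. *)
  have /choice[t tP] : forall i, exists x,
      P x /\ ((i < size s'')%N -> g x = s''`_i).
    move=> i; case: (ltnP i (size s'')) => [lti|_]; last by exists 0.
    by have [x Px gx] := Ps'' _ (mem_nth 0 lti); exists x.
  by exists t; split=> // i; have [] := tP i.
exists (mkseq t (size s'') ++ map f s'); split=> [x|x Px].
  rewrite mem_cat => /orP[/mapP[i _ ->]|/mapP[y /Ps' Py ->]] //; exact: Pt.
have [c ec] := gen'' _ (ex_intro2 _ _ x Px erefl).
pose y := \sum_(i < size s'') c i *: t i.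
have Py : P y by apply: Psum.
have /fg[z fz] : g (x - y) = 0.
  rewrite linearB /= ec linear_sum /= -sumrB big1 // => i _.
  by rewrite linearZ /= gt // subrr.
have [|d ed] := gen' z.
  by rewrite fz addrC -scaleN1r; apply: PD.
exists (fun i => if (i < size s'')%N then c i else d (i - size s'')%N).
rewrite size_cat size_mkseq size_map big_split_ord /=.
rewrite -[x](subrK y) addrC -fz ed linear_sum /=; congr (_ + _).
  apply: eq_bigr => i _ /=.
  rewrite nth_cat size_mkseq ltnNge leq_addr /= addKn.
  by rewrite (nth_map 0) // linearZ.
apply: eq_bigr => i _ /=.
by rewrite nth_cat size_mkseq ltn_ord nth_mkseq.
Qed.

Definition row0_entry n (v : 'rV[R]_(1 + n)) : R^o := v 0 0.

Fact row0_entry_linear n : linear (@row0_entry n).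
Proof. by move=> a x y; rewrite /row0_entry !mxE. Qed.

HB.instance Definition _ n := GRing.isLinear.Build R 'rV[R]_(1 + n) R^o *:%R
  (@row0_entry n) (@row0_entry_linear n).

Definition row0_cons n (w : 'rV[R]_n) : 'rV[R]_(1 + n) := row_mx 0 w.

Fact row0_cons_linear n : linear (@row0_cons n).
Proof.
by move=> a x y; rewrite /row0_cons scale_row_mx add_row_mx scaler0 addr0.
Qed.

HB.instance Definition _ n := GRing.isLinear.Build R 'rV[R]_n 'rV[R]_(1 + n)
  *:%R (@row0_cons n) (@row0_cons_linear n).

(** Induction on n along R^n -> R^(1+n) -> R, the maps being [row0_cons] and [row0_entry]. *)
Lemma noetherian_row n : noetherian R -> noetherian_module 'rV[R]_n.
Proof.
move=> hR; elim: n => [|n IHn].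
  move=> P P0 _; exists [::]; split=> // x _; exists (fun=> 0).
  by apply/rowP; case.
apply: (@noetherian_module_ext _ 'rV[R]_(1 + n) _
  (@row0_cons n) (@row0_entry n)) => //; last exact: noetherian_regular.
move=> v; split=> [v0|[w <-]]; last first.
  rewrite /= /row0_entry /row0_cons.
  have -> : (0 : 'I_(1 + n)) = lshift n 0 by apply: val_inj.
  by rewrite row_mxEl mxE.
exists (rsubmx v); rewrite -[RHS]hsubmxK; congr row_mx.
apply/rowP=> i; rewrite !mxE !ord1 -[LHS]v0 /row0_entry; congr (v _ _).
exact: val_inj.
Qed.

End NoetherianModules.

(** * Finite sums in tensor products *)

Section TensorSums.
Variable R : comPzRingType.

Lemma tens_desc_sum (M N : lmodType R) (P : zmodType) (f : M -> N -> P)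
    (I : Type) (r : seq I) (F : I -> tensor M N) : balanced f ->
  tens_desc f (\sum_(i <- r) F i) = \sum_(i <- r) tens_desc f (F i).
Proof.
by move=> fP; rewrite (big_morph _ (tens_descD fP) (tens_desc0 fP)).
Qed.

Lemma tensor_map_sum (M M' N N' : lmodType R) (u : {linear M -> M'})
    (v : {linear N -> N'}) (I : Type) (r : seq I) (F : I -> tensor M N) :
  tensor_map u v (\sum_(i <- r) F i) = \sum_(i <- r) tensor_map u v (F i).
Proof. exact: tens_desc_sum (tensor_map_balanced u v). Qed.

Variables M N : lmodType R.

Lemma tens0l n : tens (0 : M) (n : N) = 0.
Proof. by apply: (addrI (tens 0 n)); rewrite -tensDl !addr0. Qed.

Lemma tens0r x : tens (x : M) (0 : N) = 0.
Proof. by apply: (addrI (tens x 0)); rewrite -tensDr !addr0. Qed.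

Lemma tens_suml (I : Type) (r : seq I) (F : I -> M) (n : N) :
  tens (\sum_(i <- r) F i) n = \sum_(i <- r) tens (F i) n.
Proof.
exact: (big_morph (fun x => tens x n) (fun x y => tensDl x y n) (tens0l n)).
Qed.

Lemma tens_sumr (I : Type) (r : seq I) (x : M) (F : I -> N) :
  tens x (\sum_(i <- r) F i) = \sum_(i <- r) tens x (F i).
Proof. exact: (big_morph (fun n => tens x n) (tensDr x) (tens0r x)). Qed.

Lemma tensor_sumP (t : tensor M N) :
  exists s : seq (M * N), t = \sum_(p <- s) tens p.1 p.2.
Proof. by elim/quotW: t => s; exists s; rewrite tens_piE. Qed.

End TensorSums.

(** * Local dual bases from flatness *)

Section LocalDualBasis.
Variables (R : comPzRingType) (M : lmodType R).

(* By the equational criterion this says that the inclusion of every finitely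
   generated submodule of M factors through a finite free module. *)
Definition local_dual_basis : Prop :=
  forall S : fgSubmod M, exists s : seq (dual (submod S) * M),
  forall x : submod S, val x = \sum_(p <- s) (linHom_app p.1 x : R) *: p.2.

(** The equational criterion. The rows of [K] generate the left kernel of [B], so R^k -> R^n -> R^m
    is exact and remains so after tensoring with M. The solution is read off from a lift to M (x)
    R^k of the sum of the x_i (x) e_i. *)
Lemma flat_solution n m (B : 'M[R]_(n, m)) (x : 'I_n -> M) :
  noetherian R -> flat M -> (forall j, \sum_i B i j *: x i = 0) ->
  exists s : seq (M * 'rV[R]_n), (forall p, p \in s -> p.2 *m B = 0) /\
    forall i, x i = \sum_(p <- s) p.2 0 i *: p.1.
Proof.
move=> hR fM xB.
have [||k [kB kgen]] := @noetherian_row R n hR (fun v => v *m B = 0).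
- exact: mul0mx.
- by move=> a u v eu ev; rewrite mulmxDl -scalemxAl eu ev scaler0 addr0.
pose K : 'M[R]_(size k, n) := \matrix_(i < size k) k`_i.
have KB : K *m B = 0.
  by apply/row_matrixP=> i; rewrite row_mul rowK row0 kB // mem_nth.
have KBex : exact_at (mulmxr K : {linear 'rV_(size k) -> 'rV_n})
                     (mulmxr B : {linear 'rV_n -> 'rV_m}).
  move=> v; split=> [/kgen[c ->]|[u <-]]; last by rewrite /= -mulmxA KB mulmx0.
  exists (\row_i c i); rewrite /= mulmx_sum_row; apply: eq_bigr => i _.
  by rewrite mxE rowK.
pose t := \sum_i tens (x i) (delta_mx 0 i : 'rV[R]_n).
have [] := fM _ _ _ _ _ KBex t => + _.
case=> [|t' et].
  rewrite /t tensor_map_sum.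
  transitivity (\sum_i \sum_j tens (B i j *: x i) (delta_mx 0 j : 'rV[R]_m)).
    apply: eq_bigr => i _; rewrite tensor_mapE /= -rowE [row i B]row_sum_delta.
    by rewrite tens_sumr; apply: eq_bigr => j _; rewrite mxE tensZ.
  rewrite exchange_big big1 //= => j _.
  by rewrite -tens_suml xB tens0l.
have [s es] := tensor_sumP t'.
(* [ev i] induces the i-th coordinate map M (x) R^n -> M. *)
pose ev i (y : M) (v : 'rV[R]_n) := v 0 i *: y.
have evP i : balanced (ev i).
  split=> [y z v|y v w|a y v]; first exact: scalerDr.
    by rewrite /ev mxE scalerDl.
  by rewrite /ev mxE scalerA mulrC.
exists [seq (p.1, p.2 *m K) | p <- s]; split=> [p /mapP[q _ ->]|i].
  by rewrite -mulmxA KB mulmx0.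
transitivity (tens_desc (ev i) t).
  rewrite /t tens_desc_sum // (bigD1 i) //= (tens_descE (evP i)) /ev mxE.
  rewrite !eqxx scale1r big1 ?addr0 // => j ji.
  by rewrite (tens_descE (evP i)) /ev mxE eq_sym (negPf ji) andbF scale0r.
rewrite -et es tensor_map_sum tens_desc_sum // big_map.
by apply: eq_bigr => p _; rewrite tensor_mapE tens_descE.
Qed.

(** The columns of [B] generate the relations between the generators [g] of S. The criterion then
    gives rows [p.2] killed by [B], and each of them defines a linear form on S sending g_i to
    [p.2 0 i]. *)
Lemma flat_local_dual_basis : noetherian R -> flat M -> local_dual_basis.
Proof.
move=> hR fM S; have [g Sg] := fg_gen S; set n := size g.
have gS (i : 'I_n) : g`_i \in fg_mem S by rewrite Sg span_seq_nth.
have [||k [krel kgen]] :=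
  @noetherian_row R n hR (fun v => \sum_i v 0 i *: g`_i = 0).
- by rewrite big1 // => i _; rewrite mxE scale0r.
- move=> a u v eu ev.
  under eq_bigr do rewrite !mxE scalerDl -scalerA.
  by rewrite big_split /= -scaler_sumr eu ev scaler0 addr0.
pose B : 'M[R]_(n, size k) := \matrix_(i, j) (k`_j : 'rV_n) 0 i.
have [|s [sB sg]] := @flat_solution n (size k) B (fun i => g`_i) hR fM.
  move=> j; under eq_bigr do rewrite mxE.
  by apply: krel; rewrite mem_nth.
(* [p.2] is orthogonal to every relation, so the value of the form does not depend on the
   coordinates chosen. *)
have sK (p : M * 'rV[R]_n) (v : 'rV[R]_n) :
    p \in s -> \sum_i v 0 i *: g`_i = 0 -> \sum_i v 0 i * p.2 0 i = 0.
  move=> /sB/matrixP pB /kgen[c ->].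
  under eq_bigr do rewrite summxE mulr_suml.
  rewrite exchange_big big1 //= => j _.
  under eq_bigr do rewrite mxE -mulrA.
  rewrite -mulr_sumr; have := pB 0 j; rewrite !mxE => pBj.
  rewrite (_ : \sum_i _ = 0) ?mulr0 // -[RHS]pBj; apply: eq_bigr => i _.
  by rewrite !mxE mulrC.
have /choice[c cP] (x : submod S) :
    exists v : 'rV[R]_n, val x = \sum_i v 0 i *: g`_i.
  have := valP x; rewrite Sg => /asboolP[c ->]; exists (\row_i c i).
  by apply: eq_bigr => i _; rewrite mxE.
(* The coordinates [c] need not be linear in [x], but their defect of linearity is a relation, which
   [sK] kills. *)
have phiL p : p \in s ->
    linear (fun x : submod S => \sum_i c x 0 i * p.2 0 i : R^o).
  move=> ps a x y; have : val (a *: x + y) - (a *: val x + val y) = 0.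
    by rewrite linearP subrr.
  rewrite !cP scaler_sumr -big_split -sumrB /= => e.
  apply/eqP; rewrite -subr_eq0 [X in _ - (X + _)]mulr_sumr -big_split -sumrB /=.
  have e0 := sK p (c (a *: x + y) - (a *: c x + c y)) ps.
  apply/eqP; rewrite -[RHS]e0; last first.
    rewrite -[RHS]e; apply: eq_bigr => i _.
    by rewrite !mxE scalerBl scalerDl scalerA.
  by apply: eq_bigr => i _; rewrite !mxE mulrBl mulrDl mulrA.
(* Linearity is known only for [p] in [s]; the form is 0 elsewhere. *)
have /choice[phi phiE] p : exists f : dual (submod S),
    p \in s -> forall x, linHom_app f x = \sum_i c x 0 i * p.2 0 i.
  case: (boolP (p \in s)) => [ps|_]; last by exists 0.
  by exists (linHom_of (phiL p ps)).
exists [seq (phi p, p.1) | p <- s] => x; rewrite cP big_map.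
under [LHS]eq_bigr => i _ do rewrite sg scaler_sumr.
rewrite exchange_big /= big_seq [RHS]big_seq; apply: eq_bigr => p ps.
by rewrite phiE // scaler_suml; apply: eq_bigr => i _; rewrite scalerA.
Qed.

End LocalDualBasis.

(** * The square-zero extension of a ring by a module *)

Section SquareZero.
Variables (R : comPzRingType) (P : lmodType R).

Definition square_zero : Type := (R * P)%type.

HB.instance Definition _ := GRing.Zmodule.on square_zero.

Definition square_zero_mul (x y : square_zero) : square_zero :=
  (x.1 * y.1, x.1 *: y.2 + y.1 *: x.2).

Fact square_zero_mulA : associative square_zero_mul.
Proof.
move=> x y z; congr (_, _); first exact: mulrA.
by rewrite /= !scalerDr !scalerA addrA [z.1 * x.1]mulrC [z.1 * y.1]mulrC.
Qed.

Fact square_zero_mulC : commutative square_zero_mul.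
Proof. by move=> x y; congr (_, _); [exact: mulrC | exact: addrC]. Qed.

Fact square_zero_mul1 : left_id (1, 0) square_zero_mul.
Proof.
by case=> r p; congr (_, _); rewrite /= ?mul1r // scale1r scaler0 addr0.
Qed.

Fact square_zero_mulDl : left_distributive square_zero_mul +%R.
Proof.
move=> x y z; congr (_, _); first exact: mulrDl.
by rewrite /= scalerDl scalerDr addrACA.
Qed.

HB.instance Definition _ := GRing.Zmodule_isComPzRing.Build square_zero
  square_zero_mulA square_zero_mulC square_zero_mul1 square_zero_mulDl.

Definition square_zero_in (a : R) : square_zero := (a, 0).

Fact square_zero_in_additive : {morph square_zero_in : a b / a - b}.
Proof. by move=> a b; congr (_, _); rewrite /= subr0. Qed.

Fact square_zero_in_monoid : monoid_morphism square_zero_in.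
Proof.
by split=> // a b; congr (_, _); rewrite /= !scaler0 addr0.
Qed.

HB.instance Definition _ := GRing.isZmodMorphism.Build R square_zero
  square_zero_in square_zero_in_additive.
HB.instance Definition _ := GRing.isMonoidMorphism.Build R square_zero
  square_zero_in square_zero_in_monoid.

Definition square_zero_alg : comAlg R :=
  @ComAlg R square_zero (square_zero_in : {rmorphism R -> square_zero}).

Definition square_zero_inr (p : P) : algMod square_zero_alg := (0 : R, p).

Definition square_zero_snd (x : algMod square_zero_alg) : P :=
  (x : square_zero).2.

Fact square_zero_inr_linear : linear square_zero_inr.
Proof.
move=> a p q; congr (_, _); first by rewrite /= mulr0 addr0.
by rewrite /= scale0r addr0.
Qed.

Fact square_zero_snd_linear : linear square_zero_snd.
Proof. by move=> a x y; rewrite /square_zero_snd /= scaler0 addr0. Qed.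

HB.instance Definition _ := GRing.isLinear.Build R P (algMod square_zero_alg)
  *:%R square_zero_inr square_zero_inr_linear.
HB.instance Definition _ := GRing.isLinear.Build R (algMod square_zero_alg) P
  *:%R square_zero_snd square_zero_snd_linear.

End SquareZero.

(** * Pointwise criterion for isomorphisms *)

Section RmodIso.
Variables (R : comPzRingType) (F G : Rmod R) (u : RmodHom F G).

Lemma RmodIso_inj : RmodIso u -> forall A, injective (u A).
Proof. by case=> v [uK _] A; apply: can_inj (uK A). Qed.

Lemma RmodIso_surj : RmodIso u -> forall A y, exists x, u A x = y.
Proof. by case=> v [_ vK] A y; exists (v A y). Qed.

(** The pointwise inverses are linear and natural because both identities can be checked after
    applying the injective [u]. *)
Lemma bijective_RmodIso : (forall A, injective (u A)) ->
  (forall A y, exists x, u A x = y) -> RmodIso u.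
Proof.
move=> u_inj u_surj; pose v A := projT1 (choice (u_surj A)).
have vK A (y : G A) : u A (v A y) = y by apply: (projT2 (choice (u_surj A))).
have vL A : linear (v A).
  by move=> a x y; apply: u_inj; rewrite linearP !vK.
have v_nat A B (f : algHom A B) (x : G A) :
    linHom_app (linHom_of (vL B)) (fmap G f x) =
    fmap F f (linHom_app (linHom_of (vL A)) x).
  by apply: u_inj; rewrite hom_nat !vK.
exists (@MkRmodHom R G F
  (fun A => linHom_of (vL A) : {linear G A -> F A}) v_nat).
split=> A x; last exact: vK.
by apply: u_inj; apply: vK.
Qed.

End RmodIso.

Lemma colim_in_eq0 (K : pzRingType) (I : dirset) (S : modSys K I) i (x : S i) :
  colim_in S x = 0 -> exists j (h : dir_le i j), sys_map S h x = 0.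
Proof.
rewrite -(linear0 (@colim_in K I S i)) => /colim_inP[j [h [h' e]]].
by exists j, h; rewrite e linear0.
Qed.

(** * Bijectivity of the natural morphism from local dual bases *)

Section NaturalMorphism.
Variables (R : comPzRingType) (M : lmodType R).

Local Notation val_hom S := (submod_val (S := S) : {linear submod S -> M}).

(** Allows computing at any stage S, whereas [to_fg] is defined through cyclic submodules; it holds
    since [to_fg] inverts [from_fg]. *)
Lemma natural_to_sch_in A (S : fgSubmod M) (t : qcoh (submod S) A) :
  natural_to_sch M A (qcoh_hom (val_hom S) A t) =
  colim_in (sys_at (sch_sys M) A) (i := S : fg_dirset M)
    (to_sch (submod S) A t).
Proof.
rewrite -from_fg_in /= -[to_fg_fun _]/(to_fg M A (from_fg M A _)) from_fgK.
exact: (@Fcolim_hom_in R (fg_dirset M) (qcoh_sys M) (sch_sys M) _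
  (@to_sch_sys_nat R M) A S t).
Qed.

Lemma qcoh_in_fg A (t : qcoh M A) :
  exists (S : fgSubmod M) (t' : qcoh (submod S) A),
    t = qcoh_hom (val_hom S) A t'.
Proof.
have [S [t' et]] := colimW (to_fg M A t); exists S, t'.
by rewrite -from_fg_in -[from_fg_fun _]/(from_fg M A _) -et to_fgK.
Qed.

Lemma qcoh_hom_incl A (S T : fgSubmod M) (ST : subfg S T)
    (t : qcoh (submod S) A) :
  qcoh_hom (val_hom T) A (qcoh_hom (incl ST) A t) = qcoh_hom (val_hom S) A t.
Proof.
move: t; apply: tensor_ext; try by move=> t u; rewrite !linearD.
by move=> x r; rewrite /= !qcoh_hom_tens.
Qed.

Lemma qcoh_hom_sum (N N' : lmodType R) (u : {linear N -> N'}) A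
    (I : Type) (r : seq I) (x : I -> N) (a : I -> algMod A) :
  qcoh_hom u A (\sum_(i <- r) tens (x i) (a i)) =
  \sum_(i <- r) tens (u (x i)) (a i).
Proof.
rewrite [LHS]tensor_map_sum; apply: eq_bigr => i _; exact: tensor_mapE.
Qed.

Lemma linHom_app_suml (U V : lmodType R) (I : Type) (r : seq I)
    (f : I -> linHom U V) x :
  linHom_app (\sum_(i <- r) f i) x = \sum_(i <- r) linHom_app (f i) x.
Proof. exact: (big_morph (fun g : linHom U V => linHom_app g x)). Qed.

Lemma linHom_app_sumr (U V : lmodType R) (f : linHom U V) (I : Type)
    (r : seq I) (x : I -> U) :
  linHom_app f (\sum_(i <- r) x i) = \sum_(i <- r) linHom_app f (x i).
Proof. exact: (linear_sum (f : {linear U -> V})). Qed.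

Lemma to_sch_sum (N : lmodType R) A (I : Type) (r : seq I) (x : I -> N)
    (a : I -> algMod A) (w : dual N) :
  linHom_app (to_sch N A (\sum_(i <- r) tens (x i) (a i))) w =
  \sum_(i <- r) (linHom_app w (x i) : R) *: a i.
Proof.
rewrite /= /to_sch_fun tens_desc_sum; last exact: to_sch_balanced.
rewrite linHom_app_suml; apply: eq_bigr => i _.
by rewrite (tens_descE (@to_sch_balanced R N A)).
Qed.

(** At some stage T, a kernel element is a sum of z_p (x) a_p with every sum of w(z_p) a_p zero.
    Expanding z_p in the dual basis of T gathers these sums to the right of each y_l. *)
Lemma local_dual_basis_inj A :
  local_dual_basis M -> injective (natural_to_sch M A).
Proof.
move=> dM; apply: raddf_inj => t; rewrite -[_ t]/(natural_to_sch M A t).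
have [S [{}t ->]] := qcoh_in_fg t; rewrite natural_to_sch_in.
move=> /colim_in_eq0[T [ST]].
rewrite -[sys_map _ _ _]/(Fmap (sch_sys M) ST A _) -to_sch_sys_nat.
rewrite -(qcoh_hom_incl ST); move: (Fmap _ _ _ _) => {t}t.
have [r ->] := tensor_sumP t; move=> t0.
rewrite qcoh_hom_sum; have [s sP] := dM T.
have rs (phi : dual (submod T)) :
    \sum_(p <- r) (linHom_app phi p.1 : R) *: p.2 = 0.
  by rewrite -to_sch_sum t0.
under eq_bigr do rewrite /= /submod_val sP tens_suml.
rewrite exchange_big big1 //= => q _.
under eq_bigr do rewrite tensZ.
by rewrite -tens_sumr rs tens0r.
Qed.

(** For T containing S and all y_l, a form w on T restricts on S to the sum of the w(y_l) phi_l;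
    applying [k] shows that the preimage is right. *)
Lemma local_dual_basis_surj A y :
  local_dual_basis M -> exists t, natural_to_sch M A t = y.
Proof.
move=> dM; have [S [k ->]] := colimW y; have [s sP] := dM S.
have [T [ST spanT]] := subfg_directed S (fgSubmod_span (map snd s)).
have /choice[z zP] (p : dual (submod S) * M) :
    exists z : submod T, p \in s -> submod_val z = p.2.
  case: (boolP (p \in s)) => [ps|_]; last by exists 0.
  have pT : p.2 \in fg_mem T by apply/spanT/span_seq_mem/map_f.
  by exists (Sub p.2 pT).
pose t := \sum_(p <- s) tens (z p) (linHom_app k p.1).
exists (qcoh_hom (val_hom T) A t); rewrite natural_to_sch_in.
rewrite -(colim_in_map (S := sys_at (sch_sys M) A) ST); congr colim_in.
apply: linHomP => w; rewrite to_sch_sum.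
under eq_bigr do rewrite -linHomZ.
rewrite -linHom_app_sumr; congr (linHom_app k _).
apply: linHomP => x; rewrite linHom_app_suml.
rewrite -[RHS]/(linHom_app w (submod_incl ST x)).
have -> : submod_incl ST x = \sum_(p <- s) (linHom_app p.1 x : R) *: z p.
  apply: val_inj; rewrite [LHS]sP (linear_sum (val_hom T)) /=.
  rewrite big_seq [RHS]big_seq; apply: eq_bigr => p ps.
  by rewrite linearZ /= zP.
rewrite linHom_app_sumr; apply: eq_bigr => p _.
by rewrite linHom_appZ linHomZ; apply: mulrC.
Qed.

Lemma local_dual_basis_iso : local_dual_basis M -> RmodIso (natural_to_sch M).
Proof.
move=> dM; apply: bijective_RmodIso => A; first exact: local_dual_basis_inj.
by move=> y; apply: local_dual_basis_surj.
Qed.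

End NaturalMorphism.

(** * Local dual bases from the isomorphism, and flatness from local dual bases *)

Section Converse.
Variables (R : comPzRingType) (M : lmodType R).

Local Notation val_hom S := (submod_val (S := S) : {linear submod S -> M}).

(** Injectivity at the algebra R itself: z (x) 1 has zero image, hence vanishes in M (x) R, and
    multiplication M (x) R -> M returns z. *)
Lemma iso_torsionless (S : fgSubmod M) (z : submod S) :
  RmodIso (natural_to_sch M) ->
  (forall w : dual (submod S), linHom_app w z = 0) -> z = 0.
Proof.
move=> iso wz.
pose A : comAlg R := @ComAlg R R (idfun : {rmorphism R -> R}).
have t0 : tens (submod_val z) (1 : algMod A) = 0.
  apply: (RmodIso_inj iso (A := A)).
  rewrite [RHS]linear0 -[tens _ _](qcoh_hom_tens (val_hom S) z).
  rewrite -[qcoh_hom_fun _ _]/(qcoh_hom (val_hom S) A _) natural_to_sch_in.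
  rewrite (_ : to_sch _ _ _ = 0) ?linear0 //.
  apply: linHomP => w; rewrite /= to_sch_funE to_sch_tensE wz; exact: scale0r.
pose f (x : M) (a : algMod A) : M := (a : R) *: x.
have fP : balanced f.
  split=> [x y a|x a b|b x a]; first exact: scalerDr.
    exact: scalerDl.
  by rewrite /f scalerA mulrC.
apply: val_inj; rewrite linear0 /= -[LHS]scale1r.
by rewrite -[LHS](tens_descE fP) t0 tens_desc0.
Qed.

(* A universal point: surjectivity at the square-zero extension of R by the
   dual of S, applied to the inclusion of that dual. *)
Lemma iso_local_dual_basis : RmodIso (natural_to_sch M) -> local_dual_basis M.
Proof.
move=> iso S; pose A := square_zero_alg (dual (submod S)).
pose k : sch (submod S) A :=
  linHom_of (@square_zero_inr_linear R (dual (submod S))).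
have [t] := RmodIso_surj iso (colim_in (sys_at (sch_sys M) A) (i := S) k).
have [U [{}t ->]] := qcoh_in_fg t.
rewrite natural_to_sch_in => /colim_inP[T [UT [ST]]].
rewrite -[sys_map _ UT _]/(Fmap (sch_sys M) UT A _) -to_sch_sys_nat.
move: (Fmap _ _ _ _) => {}t; have [r ->] := tensor_sumP t => e.
exists [seq (square_zero_snd p.2, val p.1) | p <- r] => x; rewrite big_map /=.
pose phi (p : submod T * algMod A) := linHom_app (square_zero_snd p.2) x : R.
(* For each [w] in T^*, the second component of [e] at [w] says that [w] restricted to S is the sum
   of the w(p.1) [square_zero_snd p.2]. So every [w] vanishes on this difference. *)
have /eqP : submod_incl ST x - \sum_(p <- r) phi p *: p.1 = 0.
  apply: iso_torsionless iso _ => w.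
  have /(congr1 (fun a => linHom_app (square_zero_snd a) x)) :=
    congr1 (fun h : sch (submod T) A => linHom_app h w) e.
  rewrite to_sch_sum linear_sum linHom_app_suml.
  rewrite -[RHS]/(linHom_app w (submod_incl ST x)) => ew.
  rewrite [LHS](linearB (w : {linear submod T -> R^o})).
  apply/eqP; rewrite subr_eq0; apply/eqP.
  transitivity (linHom_app w (submod_incl ST x)) => //.
  rewrite -ew [RHS](linHom_app_sumr w); apply: eq_bigr => p _.
  by rewrite linHomZ linearZ; apply: mulrC.
rewrite subr_eq0 => /eqP/(congr1 (val_hom T)) exx.
transitivity (val_hom T (submod_incl ST x)) => //.
by rewrite exx linear_sum; apply: eq_bigr => p _; rewrite linearZ.
Qed.

(** Words in [tens_eq] have entries in all of M, so a form on S is handled as a total function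
    constrained on S only. *)
Definition linear_on (S : submodClosed M) (h : M -> R) : Prop :=
  (forall x y, x \in S -> y \in S -> h (x + y) = h x + h y) /\
  (forall a x, x \in S -> h (a *: x) = a * h x).

(* The derivation of an equality in a tensor product involves only finitely many
   elements of M, so that it holds over a finitely generated submodule. *)
Lemma tens_eq_finite (N : lmodType R) (s t : seq (M * N)) : tens_eq s t ->
  exists U : seq M, forall (S : submodClosed M) (h : M -> R),
  {subset U <= S} -> linear_on S h ->
  \sum_(p <- s) h p.1 *: p.2 = \sum_(p <- t) h p.1 *: p.2.
Proof.
elim=> {s t}.
- by exists [::].
- by move=> s t _ [U UP]; exists U => S h US hS; rewrite (UP S).
- move=> s t u _ [U UP] _ [V VP]; exists (U ++ V) => S h US hS.
  by rewrite (UP S) ?(VP S) // => x xU; apply: US; rewrite mem_cat xU ?orbT.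
- move=> s s' t t' _ [U UP] _ [V VP]; exists (U ++ V) => S h US hS.
  rewrite !big_cat (UP S) ?(VP S) // => x xU; apply: US;
    by rewrite mem_cat xU ?orbT.
- by move=> s t; exists [::] => S h _ _; rewrite !big_cat /= addrC.
- move=> n; exists [::] => S h _ [_ hZ]; rewrite big_seq1 big_nil /=.
  by have := hZ 0 0 (rpred0 S); rewrite scale0r mul0r => ->; rewrite scale0r.
- move=> x y n; exists [:: x; y] => S h US [hD _].
  rewrite big_seq1 big_cons big_seq1 /= hD ?scalerDl //;
    by apply: US; rewrite !inE eqxx ?orbT.
- move=> x m n; exists [::] => S h _ _.
  by rewrite big_seq1 big_cons big_seq1 /= scalerDr.
- move=> a x n; exists [:: x] => S h US [_ hZ].
  by rewrite !big_seq1 /= hZ ?scalerA 1?mulrC //; apply: US; rewrite inE.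
Qed.

Lemma local_dual_basis_flat : local_dual_basis M -> flat M.
Proof.
move=> dM N N' N'' f g fg t; split=> [|[u <-]]; last first.
  have [s ->] := tensor_sumP u; rewrite !tensor_map_sum big1 // => p _.
  rewrite !tensor_mapE /=; have -> : g (f p.2) = 0 by apply/fg; exists p.2.
  exact: tens0r.
have [s ->] := tensor_sumP t.
rewrite tensor_map_sum (eq_bigr _ (fun p _ => tensor_mapE idfun g p.1 p.2)) /=.
(* As 0 is the class of the empty word, vanishing becomes a derivation of [tens_eq], to which
   finiteness applies. *)
rewrite -(big_map (fun p => (p.1, g p.2)) predT (fun p => tens p.1 p.2)).
rewrite -tens_piE => /tens_piP/tens_eq_finite[U UP].
(* S contains the elements used by the derivation and the left factors of [t]. *)
pose S := fgSubmod_span (U ++ map fst s).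
have [b bP] := dM S.
(* [h phi] extends [phi] by 0 outside S. *)
pose h (phi : dual (submod S)) (x : M) : R :=
  if insub x is Some x' then linHom_app phi x' else 0.
have hE phi (x : M) (Sx : x \in fg_mem S) : h phi x = linHom_app phi (Sub x Sx).
  by rewrite /h insubT.
have hlin phi : linear_on (fg_mem S) (h phi).
  split=> [x y Sx Sy|a x Sx].
    rewrite (hE _ _ (rpredD Sx Sy)) (hE phi x Sx) (hE phi y Sy).
    apply: etrans (linHomD phi _ _); congr (linHom_app phi _).
    by apply: val_inj; rewrite linearD.
  rewrite (hE _ _ (rpredZ a Sx)) (hE phi x Sx).
  apply: etrans (linHomZ phi _ _); congr (linHom_app phi _).
  by apply: val_inj; rewrite linearZ.
have Ss p : p \in s -> p.1 \in fg_mem S.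
  by move=> ps; apply: span_seq_mem; rewrite mem_cat map_f ?orbT.
(* Applying [phi] to the left factors gives an element killed by [g], by the derivation; exactness
   lifts it along [f]. *)
have /choice[v vP] (phi : dual (submod S)) :
    exists v, f v = \sum_(p <- s) h phi p.1 *: p.2.
  apply/fg; rewrite linear_sum /=.
  have := UP (fg_mem S) (h phi) _ (hlin phi); rewrite big_nil big_map => {2}<-.
    by apply: eq_bigr => p _; rewrite linearZ.
  by move=> x Ux; apply: span_seq_mem; rewrite mem_cat Ux.
exists (\sum_(q <- b) tens q.2 (v q.1)); rewrite tensor_map_sum.
under [LHS]eq_bigr => q _ do rewrite tensor_mapE vP tens_sumr.
rewrite exchange_big /= big_seq [RHS]big_seq; apply: eq_bigr => p ps.
under eq_bigr do rewrite -tensZ.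
rewrite -tens_suml; congr (tens _ _).
apply: etrans (esym (bP (Sub p.1 (Ss p ps)))).
by apply: eq_bigr => q _; rewrite (hE _ _ (Ss p ps)).
Qed.

End Converse.

Theorem theorem3p6 (R : comPzRingType) (hR : noetherian R) (M : lmodType R) :
  flat M <-> RmodIso (natural_to_sch M).
Proof.
split=> [/(flat_local_dual_basis hR)|/iso_local_dual_basis].
  exact: local_dual_basis_iso.
exact: local_dual_basis_flat.
Qed.
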